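(* Let $X$ be a real random variable and suppose there exists $\sigma>0$ such that $\mathbb{E}[e^{\sigma X}]<\infty$ and $\mathbb{E}[e^{-\sigma X}]<\infty$. Let $w=\sigma+it$, $t\in\mathbb{R}$. Then for every $r\in\mathbb{C}$ with $\operatorname{Re}(r)>0$, $$\mathbb{E}|X|^r=\frac{\Gamma(r+1)}{2\pi}\int_{-\infty}^{\infty}\frac{M_X(w)+M_X(-w)}{w^{r+1}}\,dt,$$ where $M_X(w)=\mathbb{E}[e^{wX}]$.
   Context: $M_X(w)=\mathbb{E}[e^{wX}]$ is the (complex) moment-generating function of $X$, finite for $\operatorname{Re}(w)=\pm\sigma$ under the hypothesis. Complex powers use the principal branch of the logarithm: $w^{r+1}=\exp((r+1)\log w)$ with branch cut $(-\infty,0]$. *)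

(* Defs.v *)
From HB Require Import structures.
From mathcomp Require Import all_boot all_order all_algebra.
From mathcomp Require Import all_classical all_reals all_analysis.
From mathcomp Require Export complex.

Set Implicit Arguments.
Unset Strict Implicit.
Unset Printing Implicit Defensive.

Import Order.TTheory GRing.Theory Num.Theory.
Import numFieldNormedType.Exports.

Local Open Scope classical_set_scope.
Local Open Scope complex_scope.
Local Open Scope ring_scope.

Section ComplexFunctions.
Context {R : realType}.
Implicit Types z s : R[i].

Definition cmod z : R := Num.sqrt (complex.Re z ^+ 2 + complex.Im z ^+ 2).

Definition cexp z : R[i] :=
  (expR (complex.Re z))%:C * (cos (complex.Im z) +i* sin (complex.Im z)).

(* Principal argument, in ]-pi, pi] for z != 0. *)
Definition carg z : R :=
  if 0 <= complex.Im z then acos (complex.Re z / cmod z)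
  else - acos (complex.Re z / cmod z).

Definition clog z : R[i] := ln (cmod z) +i* carg z.

(* As for powR, the value at base 0 is 0, except that 0 ^ 0 = 1. *)
Definition cpow z s : R[i] :=
  if z == 0 then (s == 0)%:R else cexp (s * clog z).

End ComplexFunctions.

Section ComplexIntegral.
Context {d : measure_display} {T : measurableType d} {R : realType}.
Variable mu : {measure set T -> \bar R}.
Implicit Types (D : set T) (f : T -> R[i]).

Definition cintegrable D f : Prop :=
  mu.-integrable D (fun x => (complex.Re (f x))%:E) /\
  mu.-integrable D (fun x => (complex.Im (f x))%:E).

(* Only meaningful when cintegrable D f holds: Rintegral is total. *)
Definition cintegral D f : R[i] :=
  (\int[mu]_(x in D) complex.Re (f x)) +i*
  (\int[mu]_(x in D) complex.Im (f x)).

End ComplexIntegral.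

(* Euler's integral, which is the Gamma function on the half-plane Re z > 0. *)
Definition cGamma {R : realType} (z : R[i]) : R[i] :=
  cintegral lebesgue_measure `]0, +oo[
    (fun t : R => cpow t%:C (z - 1) * (expR (- t))%:C).

Definition cexpectation {d : measure_display} {T : measurableType d}
    {R : realType} (P : probability T R) (f : T -> R[i]) : R[i] :=
  cintegral P setT f.

Definition cmgf {d : measure_display} {T : measurableType d}
    {R : realType} (P : probability T R) (X : T -> R) (w : R[i]) : R[i] :=
  cexpectation P (fun x => cexp (w * (X x)%:C)).

(* Main.v *)
Require Import Defs.
From mathcomp Require Import all_boot all_order all_algebra.
From mathcomp Require Import all_classical all_reals all_analysis.
From mathcomp Require Import measurable_realfun ring lra.
Import Order.TTheory GRing.Theory Num.Theory.
Import numFieldNormedType.Exports.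
Local Open Scope classical_set_scope.
Local Open Scope complex_scope.
Local Open Scope ring_scope.

Set Implicit Arguments.
Unset Strict Implicit.
Unset Printing Implicit Defensive.

(** For every real x, the Laplace inversion formula

      Gamma(r+1) * \int_R e^(w x) / w^(r+1) dt = 2 pi (x_+)^r,   w = sigma + i t,

    holds; applied at X and at -X and integrated over the probability space, it
    gives the theorem by Fubini, since |w|^-(Re r + 1) is integrable on the line
    and e^(sigma X) + e^(-sigma X) is integrable on the space.

    The inversion formula is Fourier inversion for g(y) = (y_+)^r e^(-sigma y).
    Its transform is Gamma(r+1) / w^(r+1): writing w = e^zeta, the integral over
    y > 0 of k(s, y) = e^((r+1) s zeta) y^r exp(- e^(s zeta) y) does not depend
    on s, because d/ds k = zeta d/dy (y k), and it is Gamma(r+1) at s = 0.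
    Inserting e^(-eps |t|) in the inversion integral turns it into the Poisson
    integral of g, which tends to 2 pi g(x) because g is bounded and continuous. *)

(** The path e^(s zeta) is a segment in the logarithmic plane. Its argument s Im zeta stays below
    pi/2 in absolute value, so its real part is bounded below uniformly in s in [0, 1], and one
    exponential majorant serves for k and for its derivatives. The factor e^((r+1) s zeta) is what
    makes the s-derivative an exact y-derivative: both are (r + 1 - e^(s zeta) y) k, up to the
    factor zeta. A rotation of contour thus becomes a real Fubini argument on [0, 1] x ]0, +oo[. The
    damping e^(-eps |t|) is there because g(y) e^(i t (x - y)) is not absolutely integrable in (t,
    y), so Fubini does not apply to it. It is removed on both sides by dominated convergence: in t
    the majorant is a multiple of (sigma + |t|)^-(Re r + 1), and after the substitution y = x + eps
    u it is a multiple of 1 / (1 + u^2). Re r > 0 enters here both through the decay in t and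
    through the continuity of g at 0. *)

Local Notation Re := complex.Re.
Local Notation Im := complex.Im.

(** * Complex modulus, exponential and principal logarithm *)

Section ComplexAlgebra.
Context {R : realType}.
Implicit Types (x y : R) (z s : R[i]).

Lemma complexP z s : Re z = Re s -> Im z = Im s -> z = s.
Proof. by case: z s => [a b] [c d] /= -> ->. Qed.

Lemma cReD z s : Re (z + s) = Re z + Re s. Proof. by case: z s => [??] []. Qed.
Lemma cImD z s : Im (z + s) = Im z + Im s. Proof. by case: z s => [??] []. Qed.
Lemma cReN z : Re (- z) = - Re z. Proof. by case: z. Qed.
Lemma cImN z : Im (- z) = - Im z. Proof. by case: z. Qed.
Lemma cReM z s : Re (z * s) = Re z * Re s - Im z * Im s.
Proof. by case: z s => [??] []. Qed.
Lemma cImM z s : Im (z * s) = Re z * Im s + Im z * Re s.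
Proof. by case: z s => [??] []. Qed.

Lemma cmodE z : `|z| = (cmod z)%:C.
Proof. exact: normc_def. Qed.

Lemma cmod_ge0 z : 0 <= cmod z.
Proof. exact: sqrtr_ge0. Qed.

Lemma cmodM z s : cmod (z * s) = cmod z * cmod s.
Proof. by apply: complexI; rewrite rmorphM/= -!cmodE normrM. Qed.

Lemma cmodN z : cmod (- z) = cmod z.
Proof. by apply: complexI; rewrite -!cmodE normrN. Qed.

Lemma le_cmodD z s : cmod (z + s) <= cmod z + cmod s.
Proof. by rewrite -lecR rmorphD/= -!cmodE ler_normD. Qed.

Lemma cmod_eq0 z : (cmod z == 0) = (z == 0).
Proof. by rewrite -(inj_eq (@complexI R)) -cmodE normr_eq0. Qed.

Lemma sqr_cmod z : cmod z ^+ 2 = Re z ^+ 2 + Im z ^+ 2.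
Proof. by rewrite /cmod sqr_sqrtr// addr_ge0 ?sqr_ge0. Qed.

Lemma normr_Re_le z : `|Re z| <= cmod z.
Proof. by rewrite -sqrtr_sqr ler_wsqrtr// lerDl sqr_ge0. Qed.

Lemma normr_Im_le z : `|Im z| <= cmod z.
Proof. by rewrite -sqrtr_sqr ler_wsqrtr// lerDr sqr_ge0. Qed.

Lemma cmod_real x : cmod x%:C = `|x|.
Proof. by rewrite /cmod/= expr0n addr0 sqrtr_sqr. Qed.

Lemma cmod0 : cmod (0 : R[i]) = 0.
Proof. by rewrite (cmod_real 0) normr0. Qed.

Lemma cmod_cexp z : cmod (cexp z) = expR (Re z).
Proof.
rewrite /cexp cmodM cmod_real ger0_norm ?expR_ge0//.
by rewrite /cmod /= cos2Dsin2 sqrtr1 mulr1.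
Qed.

Lemma Re_cexp z : Re (cexp z) = expR (Re z) * cos (Im z).
Proof. by rewrite /cexp cReM/= mul0r subr0. Qed.

Lemma Im_cexp z : Im (cexp z) = expR (Re z) * sin (Im z).
Proof. by rewrite /cexp cImM/= mul0r addr0. Qed.

Lemma cexpD z s : cexp (z + s) = cexp z * cexp s.
Proof.
apply: complexP.
  by rewrite Re_cexp cReM !Re_cexp !Im_cexp cReD cImD expRD cosD; ring.
by rewrite Im_cexp cImM !Re_cexp !Im_cexp cReD cImD expRD sinD; ring.
Qed.

Lemma cexp0 : cexp 0 = 1 :> R[i].
Proof. by apply: complexP; rewrite ?Re_cexp ?Im_cexp/= expR0 (cos0, sin0) mul1r. Qed.

Lemma cexp_neq0 z : cexp z != 0.
Proof. by rewrite -cmod_eq0 cmod_cexp gt_eqF ?expR_gt0. Qed.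

Lemma cexpN z : cexp (- z) = (cexp z)^-1.
Proof.
apply: (mulfI (cexp_neq0 z)).
by rewrite -cexpD subrr cexp0 mulfV ?cexp_neq0.
Qed.

Lemma cexp_real x : cexp x%:C = (expR x)%:C.
Proof. by apply: complexP; rewrite ?Re_cexp ?Im_cexp/= (cos0, sin0) (mulr1, mulr0). Qed.

Lemma clog_real x : 0 < x -> clog x%:C = (ln x)%:C.
Proof.
move=> x0; rewrite /clog cmod_real gtr0_norm// /carg/= lexx cmod_real.
by rewrite gtr0_norm// divff ?gt_eqF// acos1.
Qed.

Lemma cpow_real x s : 0 < x -> cpow x%:C s = cexp (s * (ln x)%:C).
Proof.
by move=> x0; rewrite /cpow clog_real// eq_complex/= gt_eqF.
Qed.

(** The [acos] form of the definition splits on the sign of [Im z]; the [atan] form is visibly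
    measurable along a vertical line and bounded by pi/2. *)
Lemma carg_Re_gt0 z : 0 < Re z -> carg z = atan (Im z / Re z).
Proof.
move=> z0; have m0 : 0 < cmod z.
  by rewrite (lt_le_trans z0)// (le_trans _ (normr_Re_le z))// ler_norm.
have c1 : -1 <= Re z / cmod z <= 1.
  by rewrite -ler_norml normrM normfV (ger0_norm (cmod_ge0 z)) ler_pdivrMr// mul1r normr_Re_le.
(* A positive cosine keeps [acos] below pi/2, in the range where [atan] inverts [tan]. *)
have ac0 : 0 <= acos (Re z / cmod z) < pi / 2.
  rewrite acos_ge0//= -ltr_cos ?in_itv/= ?acos_ge0 ?acos_lepi//; last first.
    by rewrite divr_ge0 ?pi_ge0//= ler_pdivrMr// ler_peMr ?pi_ge0 ?ler1n.
  by rewrite cos_pihalf acosK ?in_itv// divr_gt0.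
suff tE : tan (acos (Re z / cmod z)) = `|Im z| / Re z.
  rewrite /carg; have [Im0|Im0] := leP 0 (Im z).
    rewrite -(ger0_norm Im0) -tE tanK// in_itv/=.
    by case/andP: ac0 => a0 ->; rewrite andbT (lt_le_trans _ a0)// oppr_lt0 divr_gt0 ?pi_gt0.
  rewrite -[Im z]opprK -(ltr0_norm Im0) mulNr atanN -tE tanK// in_itv/=.
  by case/andP: ac0 => a0 ->; rewrite andbT (lt_le_trans _ a0)// oppr_lt0 divr_gt0 ?pi_gt0.
rewrite /tan acosK ?in_itv// sin_acos//.
have -> : 1 - (Re z / cmod z) ^+ 2 = (`|Im z| / cmod z) ^+ 2.
  rewrite !expr_div_n -normrX (ger0_norm (sqr_ge0 _)) sqr_cmod.
  have : cmod z ^+ 2 != 0 by rewrite expf_neq0 ?gt_eqF.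
  by rewrite sqr_cmod => h; field.
rewrite sqrtr_sqr ger0_norm ?divr_ge0 ?(ltW m0)//.
by field; rewrite !gt_eqF.
Qed.

Lemma normr_carg_lt z : 0 < Re z -> `|carg z| < pi / 2.
Proof. by move=> z0; rewrite carg_Re_gt0// ltr_norml atan_gtNpi2 atan_ltpi2. Qed.

(** The cosine is read off [acos]; the sine is recovered as tan times cos from the [atan] form,
    which carries the sign of [Im z]. *)
Lemma clogK z : 0 < Re z -> cexp (clog z) = z.
Proof.
move=> z0; have m0 : 0 < cmod z.
  by rewrite (lt_le_trans z0)// (le_trans _ (normr_Re_le z))// ler_norm.
have c1 : -1 <= Re z / cmod z <= 1.
  by rewrite -ler_norml normrM normfV (ger0_norm (cmod_ge0 z)) ler_pdivrMr// mul1r normr_Re_le.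
have cE : cos (carg z) = Re z / cmod z.
  by rewrite /carg; case: ifP => _; rewrite ?cosN acosK ?in_itv.
have sE : sin (carg z) = tan (carg z) * cos (carg z).
  rewrite /tan mulfVK// cE gt_eqF// divr_gt0//.
rewrite {2}carg_Re_gt0// atanK in sE.
apply: complexP; rewrite ?Re_cexp ?Im_cexp/= lnK ?posrE// ?sE cE; field; rewrite ?gt_eqF//.
Qed.

End ComplexAlgebra.

(** * Complex-valued integration *)

Section ComplexMeasurability.
Context {d : measure_display} {T : measurableType d} {R : realType}.
Implicit Types (f g : T -> R[i]) (h : T -> R).

Definition cmeasurable f :=
  measurable_fun setT (fun x => Re (f x)) /\
  measurable_fun setT (fun x => Im (f x)).

Lemma cmeasurable_cst (c : R[i]) : cmeasurable (fun=> c).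
Proof. by split; exact: measurable_cst. Qed.

Lemma cmeasurable_real h : measurable_fun setT h -> cmeasurable (fun x => (h x)%:C).
Proof. by move=> mh; split => //=; exact: measurable_cst. Qed.

Lemma cmeasurable_pair (h k : T -> R) :
  measurable_fun setT h -> measurable_fun setT k -> cmeasurable (fun x => h x +i* k x).
Proof. by []. Qed.

Lemma cmeasurableD f g : cmeasurable f -> cmeasurable g -> cmeasurable (fun x => f x + g x).
Proof.
move=> [fr fi] [gr gi]; split.
  by under eq_fun do rewrite cReD; exact: measurable_funD.
by under eq_fun do rewrite cImD; exact: measurable_funD.
Qed.

Lemma cmeasurableN f : cmeasurable f -> cmeasurable (fun x => - f x).
Proof.
move=> [fr fi]; split.
  by under eq_fun do rewrite cReN; exact: measurableT_comp.
by under eq_fun do rewrite cImN; exact: measurableT_comp.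
Qed.

Lemma cmeasurableM f g : cmeasurable f -> cmeasurable g -> cmeasurable (fun x => f x * g x).
Proof.
move=> [fr fi] [gr gi]; split.
  by under eq_fun do rewrite cReM; apply: measurable_funB; exact: measurable_funM.
by under eq_fun do rewrite cImM; apply: measurable_funD; exact: measurable_funM.
Qed.

Lemma cmeasurable_cexp f : cmeasurable f -> cmeasurable (fun x => cexp (f x)).
Proof.
move=> [fr fi]; split.
  under eq_fun do rewrite Re_cexp; apply: measurable_funM.
    exact: measurableT_comp.
  by apply: measurableT_comp => //; apply: continuous_measurable_fun; exact: continuous_cos.
under eq_fun do rewrite Im_cexp; apply: measurable_funM.
  exact: measurableT_comp.
by apply: measurableT_comp => //; apply: continuous_measurable_fun; exact: continuous_sin.
Qed.

Lemma cmeasurable_if (b : T -> bool) f g : measurable_fun setT b ->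
  cmeasurable f -> cmeasurable g -> cmeasurable (fun x => if b x then f x else g x).
Proof.
move=> mb [fr fi] [gr gi]; split.
  under eq_fun do rewrite (fun_if (@complex.Re R)).
  by apply: measurable_fun_ifT.
under eq_fun do rewrite (fun_if (@complex.Im R)).
by apply: measurable_fun_ifT.
Qed.

End ComplexMeasurability.

Lemma cmeasurable_comp {d d' : measure_display} {T : measurableType d}
    {T' : measurableType d'} {R : realType} (f : T -> R[i]) (h : T' -> T) :
  cmeasurable f -> measurable_fun setT h -> cmeasurable (fun x => f (h x)).
Proof. move=> [fr fi] mh; split.
  exact: (measurableT_comp (f := fun x => Re (f x)) _ mh).
exact: (measurableT_comp (f := fun x => Im (f x)) _ mh). Qed.

(** * Componentwise limits of complex sequences *)

Section ComplexSequences.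
Context {R : realType}.
Implicit Types (u v : nat -> R[i]) (l : R[i]).

Definition ccvg u l :=
  Re (u n) @[n --> \oo] --> Re l /\ Im (u n) @[n --> \oo] --> Im l.

Lemma ccvg_unique u l l' : ccvg u l -> ccvg u l' -> l = l'.
Proof.
move=> [ur ui] [ur' ui']; apply: complexP.
  exact: (cvg_unique _ ur ur').
exact: (cvg_unique _ ui ui').
Qed.

Lemma ccvg_cst l : ccvg (fun=> l) l.
Proof. by split; exact: cvg_cst. Qed.

Lemma ccvg_real (u : nat -> R) (l : R) :
  u n @[n --> \oo] --> l -> ccvg (fun n => (u n)%:C) l%:C.
Proof. by move=> ul; split => //=; exact: cvg_cst. Qed.

Lemma ccvgB u v l l' : ccvg u l -> ccvg v l' -> ccvg (fun n => u n - v n) (l - l').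
Proof.
move=> [ur ui] [vr vi]; split.
  by rewrite cReD cReN; under eq_fun do rewrite cReD cReN; exact: cvgB.
by rewrite cImD cImN; under eq_fun do rewrite cImD cImN; exact: cvgB.
Qed.

Lemma ccvgM u v l l' : ccvg u l -> ccvg v l' -> ccvg (fun n => u n * v n) (l * l').
Proof.
move=> [ur ui] [vr vi]; split.
  by rewrite cReM; under eq_fun do rewrite cReM; apply: cvgB; exact: cvgM.
by rewrite cImM; under eq_fun do rewrite cImM; apply: cvgD; exact: cvgM.
Qed.

Lemma ccvg_cexp u l : ccvg u l -> ccvg (fun n => cexp (u n)) (cexp l).
Proof.
move=> [ur ui]; split.
  rewrite Re_cexp; under eq_fun do rewrite Re_cexp.
  apply: cvgM; apply: continuous_cvg => //; [exact: continuous_expR|exact: continuous_cos].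
rewrite Im_cexp; under eq_fun do rewrite Im_cexp.
apply: cvgM; apply: continuous_cvg => //; [exact: continuous_expR|exact: continuous_sin].
Qed.

Lemma ccvg_near u l : (\forall n \near \oo, u n = l) -> ccvg u l.
Proof.
by move=> h; split; apply: cvg_near_cst; apply: filterS h => n ->.
Qed.

Lemma ccvg_squeeze u l (e : nat -> R) : (\forall n \near \oo, cmod (u n - l) <= e n) ->
  e n @[n --> \oo] --> 0 -> ccvg u l.
Proof.
move=> ue e0; split; apply/cvgrPdistC_lt => eps eps0.
  near=> n; rewrite -cReN -cReD.
  rewrite (le_lt_trans (normr_Re_le _))//.
  have : cmod (u n - l) <= e n by near: n.
  move/le_lt_trans; apply.
  by near: n; move/cvgr_lt : e0; apply.
near=> n; rewrite -cImN -cImD.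
rewrite (le_lt_trans (normr_Im_le _))//.
have : cmod (u n - l) <= e n by near: n.
move/le_lt_trans; apply.
by near: n; move/cvgr_lt : e0; apply.
Unshelve. all: by end_near. Qed.

End ComplexSequences.

Section ComplexIntegration.
Context {d : measure_display} {T : measurableType d} {R : realType}.
Variables (mu : {measure set T -> \bar R}) (D : set T).
Hypothesis mD : measurable D.
Implicit Types (f g : T -> R[i]) (h : T -> R).

Lemma cintegrable_dominated f h : cmeasurable f ->
  mu.-integrable D (fun x => (h x)%:E) ->
  (forall x, D x -> cmod (f x) <= h x) -> cintegrable mu D f.
Proof.
move=> [fr fi] ih fh; split; apply: le_integrable ih => //.
- exact/measurable_EFinP/measurable_funTS.
- move=> x Dx; rewrite /= lee_fin (le_trans (normr_Re_le _))// (le_trans (fh _ Dx))//.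
  exact: ler_norm.
- exact/measurable_EFinP/measurable_funTS.
- move=> x Dx; rewrite /= lee_fin (le_trans (normr_Im_le _))// (le_trans (fh _ Dx))//.
  exact: ler_norm.
Qed.

Lemma eq_cintegral f g : (forall x, D x -> f x = g x) ->
  cintegral mu D f = cintegral mu D g.
Proof.
by move=> fg; congr (_ +i* _); apply: eq_Rintegral => x /set_mem /fg ->.
Qed.

Lemma eq_cintegrable f g : (forall x, D x -> f x = g x) ->
  cintegrable mu D f -> cintegrable mu D g.
Proof.
move=> fg [fr fi]; split; [apply: eq_integrable fr => // x /set_mem /fg ->//|].
by apply: eq_integrable fi => // x /set_mem /fg ->.
Qed.

Lemma cintegrableD f g : cintegrable mu D f -> cintegrable mu D g ->
  cintegrable mu D (fun x => f x + g x).
Proof.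
move=> [fr fi] [gr gi]; split.
  by under eq_fun do rewrite cReD EFinD; exact: integrableD.
by under eq_fun do rewrite cImD EFinD; exact: integrableD.
Qed.

Lemma cintegralD f g : cintegrable mu D f -> cintegrable mu D g ->
  cintegral mu D (fun x => f x + g x) = cintegral mu D f + cintegral mu D g.
Proof.
move=> [fr fi] [gr gi]; apply: complexP.
  by rewrite cReD/= -RintegralD//; apply: eq_Rintegral => x _; rewrite cReD.
by rewrite cImD/= -RintegralD//; apply: eq_Rintegral => x _; rewrite cImD.
Qed.

Lemma cintegrableZ (c : R[i]) f : cintegrable mu D f ->
  cintegrable mu D (fun x => c * f x).
Proof.
move=> [fr fi]; split.
  under eq_fun do rewrite cReM EFinB !EFinM.
  by apply: integrableB => //; exact: integrableZl.
under eq_fun do rewrite cImM EFinD !EFinM.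
by apply: integrableD => //; exact: integrableZl.
Qed.

Lemma cintegralZ (c : R[i]) f : cintegrable mu D f ->
  cintegral mu D (fun x => c * f x) = c * cintegral mu D f.
Proof.
move=> [fr fi].
have Zr k h : mu.-integrable D (fun x => (h x)%:E) ->
    mu.-integrable D (EFin \o (fun x => k * h x)).
  by move=> ih; rewrite /comp; under eq_fun do rewrite EFinM; exact: integrableZl.
apply: complexP.
  rewrite cReM/= -!RintegralZl// -RintegralB ?Zr//.
  by apply: eq_Rintegral => x _; rewrite cReM.
rewrite cImM/= -!RintegralZl// -RintegralD ?Zr//.
by apply: eq_Rintegral => x _; rewrite cImM.
Qed.

Lemma cmeasurable_restrict f : cmeasurable f ->
  cmeasurable (fun x => (\1_D x)%:C * f x).
Proof.
by move=> mf; apply: cmeasurableM => //; apply: cmeasurable_real; exact: measurable_indic.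
Qed.

(** An indicator factor moves the domain into the integrand, so that integrals over varying domains
    can be compared by dominated convergence on one space. *)
Lemma cintegral_restrict f :
  cintegral mu setT (fun x => (\1_D x)%:C * f x) = cintegral mu D f.
Proof.
apply: complexP; rewrite /= [RHS]Rintegral_mkcond; apply: eq_Rintegral => x _.
  by rewrite cReM/= mul0r subr0 patchE indicE; case: ifP => xD; rewrite ?mul1r ?mul0r.
by rewrite cImM/= mul0r addr0 patchE indicE; case: ifP => xD; rewrite ?mul1r ?mul0r.
Qed.

Lemma cintegral_dominated_cvg (f_ : nat -> T -> R[i]) f h :
  (forall n, cmeasurable (f_ n)) -> cmeasurable f ->
  mu.-integrable D (fun x => (h x)%:E) ->
  (forall n x, D x -> cmod (f_ n x) <= h x) ->
  (forall x, D x -> ccvg (f_ ^~ x) (f x)) ->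
  ccvg (fun n => cintegral mu D (f_ n)) (cintegral mu D f).
Proof.
move=> mf_ [fr fi] ih f_h cf.
have main (u_ : nat -> T -> R) (u : T -> R) :
    (forall n, measurable_fun setT (u_ n)) -> measurable_fun setT u ->
    (forall n x, D x -> `|u_ n x| <= h x) ->
    (forall x, D x -> u_ n x @[n --> \oo] --> u x) ->
    \int[mu]_(x in D) u_ n x @[n --> \oo] --> \int[mu]_(x in D) u x.
  move=> mu_ mu0 uh uc.
  have mEu n : measurable_fun D (fun x => (u_ n x)%:E).
    exact/measurable_EFinP/measurable_funTS.
  have mE : measurable_fun D (fun x => (u x)%:E).
    exact/measurable_EFinP/measurable_funTS.
  have [||iu _ cu] := @dominated_convergence _ _ _ mu _ mD
    (fun n x => (u_ n x)%:E) (fun x => (u x)%:E) (fun x => (h x)%:E) mEu mE _ ih.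
  - by apply: aeW => x Dx; apply: cvg_EFin; [exact: nearW|exact: uc].
  - by apply: aeW => x n Dx; rewrite lee_fin; exact: uh.
  apply: fine_cvg; rewrite fineK//.
  exact: integrable_fin_num.
split; apply: main => //.
- by move=> n; case: (mf_ n).
- by move=> n x Dx; rewrite (le_trans (normr_Re_le _))// f_h.
- by move=> x /cf[].
- by move=> n; case: (mf_ n).
- by move=> n x Dx; rewrite (le_trans (normr_Im_le _))// f_h.
- by move=> x /cf[].
Qed.

End ComplexIntegration.

(** * Fubini's theorem under a product majorant *)

Section ComplexFubini.
Context {d1 d2 : measure_display} {T1 : measurableType d1} {T2 : measurableType d2}
  {R : realType}.
Variables (m1 : {sigma_finite_measure set T1 -> \bar R})
          (m2 : {sigma_finite_measure set T2 -> \bar R}).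
Variables (D1 : set T1) (D2 : set T2) (g1 : T1 -> R) (g2 : T2 -> R).
Hypotheses (mD1 : measurable D1) (mD2 : measurable D2).
Hypotheses (ig1 : m1.-integrable D1 (fun x => (g1 x)%:E))
           (ig2 : m2.-integrable D2 (fun x => (g2 x)%:E)).

(** The product majorant makes the extension of [f] by zero integrable on the product space. The
    first conclusion is kept because the convergence claim for the integral over the line is drawn
    from it. *)
Lemma Rintegral_Fubini (f : T1 * T2 -> R) : measurable_fun setT f ->
  (forall x y, D1 x -> D2 y -> `|f (x, y)| <= g1 x * g2 y) ->
  m1.-integrable D1 (fun x => (\int[m2]_(y in D2) f (x, y))%:E) /\
  \int[m1]_(x in D1) \int[m2]_(y in D2) f (x, y) =
  \int[m2]_(y in D2) \int[m1]_(x in D1) f (x, y).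
Proof.
move=> mf fg.
pose F z : R := \1_D1 z.1 * \1_D2 z.2 * f z.
have mF : measurable_fun setT F.
  apply: measurable_funM => //; apply: measurable_funM.
    by apply: (measurableT_comp (f := \1_D1 : T1 -> R)) => //; exact: measurable_indic.
  by apply: (measurableT_comp (f := \1_D2 : T2 -> R)) => //; exact: measurable_indic.
have FE1 x y : F (x, y) = \1_D1 x * ((fun y => f (x, y)) \_ D2) y.
  rewrite /F/= -mulrA; congr (_ * _); rewrite patchE indicE.
  by case: ifP; rewrite ?mul1r ?mul0r.
have FE2 x y : F (x, y) = \1_D2 y * ((fun x => f (x, y)) \_ D1) x.
  rewrite /F/= [_ * \1_D2 y]mulrC -mulrA; congr (_ * _); rewrite patchE indicE.
  by case: ifP; rewrite ?mul1r ?mul0r.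
pose G1 := g1 \_ D1. pose G2 := g2 \_ D2.
have iG1 : m1.-integrable setT (fun x => (G1 x)%:E).
  by move/(integrable_mkcond _ mD1) : ig1; rewrite restrict_EFin.
have iG2 : m2.-integrable setT (fun x => (G2 x)%:E).
  by move/(integrable_mkcond _ mD2) : ig2; rewrite restrict_EFin.
have FG x y : `|F (x, y)| <= `|G1 x| * `|G2 y|.
  rewrite /F/G1/G2 !patchE /= !indicE.
  case: ifPn => [|]; last by rewrite !mul0r normr0 mul0r.
  move=> /set_mem D1x; case: ifPn; last by rewrite mulr0 mul0r !normr0 mulr0.
  by move=> /set_mem D2y; rewrite !mul1r -normrM (le_trans (fg _ _ D1x D2y))// ler_norm.
have iF : (m1 \x m2)%E.-integrable setT (EFin \o F).
  apply/integrable12ltyP; first exact/measurable_EFinP.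
  (* Tonelli: the iterated integral of |F| is at most the product of the integrals of |G1| and
     |G2|. *)
  apply: (@le_lt_trans _ _ (\int[m1]_x (`|G1 x|%:E * \int[m2]_y `|(G2 y)%:E|))%E).
    apply: ge0_le_integral => //.
    - by move=> x _; exact: integral_ge0.
    - apply: (@measurable_fun_fubini_tonelli_F _ _ _ _ _ m2 (fun z => `|(F z)%:E|%E)) => //.
      by apply: measurableT_comp => //; exact/measurable_EFinP.
    - apply: emeasurable_funM => //.
      apply/measurable_EFinP; apply: measurableT_comp => //.
      by apply/measurable_EFinP; exact: measurable_int iG1.
    - move=> x _; rewrite -ge0_integralZl//; last first.
        by apply: measurableT_comp => //; exact: measurable_int iG2.
      apply: ge0_le_integral => //.
      + apply: measurableT_comp => //; apply/measurable_EFinP.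
        exact: (measurableT_comp mF).
      + apply: emeasurable_funM => //; apply: measurableT_comp => //.
        exact: measurable_int iG2.
      + by move=> y _; rewrite /= -EFinM lee_fin FG.
  move/integrableP : iG2 => [_ iG2].
  have fG2 : (\int[m2]_y `|(G2 y)%:E| \is a fin_num)%E.
    by rewrite ge0_fin_numE//; exact: integral_ge0.
  rewrite -(fineK fG2) ge0_integralZr//; last 2 first.
    apply/measurable_EFinP; apply: measurableT_comp => //.
    by apply/measurable_EFinP; exact: measurable_int iG1.
    by rewrite lee_fin fine_ge0//; exact: integral_ge0.
  rewrite lte_mul_pinfty ?integral_ge0//.
    rewrite ge0_fin_numE//; last exact: integral_ge0.
    by case/integrableP : iG1.
  by rewrite ltry.
(* Integrability of each slice makes its extended-real integral finite, so that [fine] inside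
   [Rintegral] loses nothing. *)
have i2 x : D1 x -> m2.-integrable D2 (fun y => (f (x, y))%:E).
  move=> D1x; apply: (@le_integrable _ _ _ m2 D2 mD2 _ (fun y => ((g1 x)%:E * (g2 y)%:E)%E)).
  - exact/measurable_EFinP/measurable_funTS/(measurableT_comp mf).
  - by move=> y D2y; rewrite -EFinM /= lee_fin (le_trans (fg _ _ _ _))// ler_norm.
  - exact: integrableZl.
have i1 y : D2 y -> m1.-integrable D1 (fun x => (f (x, y))%:E).
  move=> D2y; apply: (@le_integrable _ _ _ m1 D1 mD1 _ (fun x => ((g2 y)%:E * (g1 x)%:E)%E)).
  - exact/measurable_EFinP/measurable_funTS/(measurableT_comp mf).
  - by move=> x D1x; rewrite -EFinM /= lee_fin (le_trans (fg _ _ _ _))// mulrC ler_norm.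
  - exact: integrableZl.
have E1 x : (\int[m2]_y (F (x, y))%:E)%E =
    (((fun x => \int[m2]_(y in D2) f (x, y)) \_ D1) x)%:E.
  rewrite patchE; case: ifPn => [/set_mem D1x|xD1]; last first.
    by apply: integral0_eq => y _; rewrite FE1 indicE (negbTE xD1) mul0r.
  rewrite /Rintegral fineK; last exact: integrable_fin_num (i2 _ D1x).
  rewrite [RHS]integral_mkcond; apply: eq_integral => y _.
  by rewrite FE1 indicE mem_set// mul1r [in RHS]patchE patchE; case: ifP.
have E2 y : (\int[m1]_x (F (x, y))%:E)%E =
    (((fun y => \int[m1]_(x in D1) f (x, y)) \_ D2) y)%:E.
  rewrite patchE; case: ifPn => [/set_mem D2y|yD2]; last first.
    by apply: integral0_eq => x _; rewrite FE2 indicE (negbTE yD2) mul0r.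
  rewrite /Rintegral fineK; last exact: integrable_fin_num (i1 _ D2y).
  rewrite [RHS]integral_mkcond; apply: eq_integral => x _.
  by rewrite FE2 indicE mem_set// mul1r [in RHS]patchE patchE; case: ifP.
split.
  have := integrable_fubini_F iF.
  rewrite /fubini_F /= (_ : (fun x => _) =
    (fun x => (((fun x => \int[m2]_(y in D2) f (x, y)) \_ D1) x)%:E)); last first.
    by apply/funext => x; rewrite E1.
  by move=> h; apply/(integrable_mkcond _ mD1); rewrite restrict_EFin.
have := Fubini iF; rewrite /=.
under eq_integral do rewrite E1.
under [in X in _ = X -> _]eq_integral do rewrite E2.
by move=> /(congr1 fine) h; rewrite Rintegral_mkcond [RHS]Rintegral_mkcond.
Qed.

Lemma cintegral_Fubini (f : T1 * T2 -> R[i]) : cmeasurable f ->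
  (forall x y, D1 x -> D2 y -> cmod (f (x, y)) <= g1 x * g2 y) ->
  cintegrable m1 D1 (fun x => cintegral m2 D2 (fun y => f (x, y))) /\
  cintegral m1 D1 (fun x => cintegral m2 D2 (fun y => f (x, y))) =
  cintegral m2 D2 (fun y => cintegral m1 D1 (fun x => f (x, y))).
Proof.
move=> [fr fi] fg.
have [|ir er] := @Rintegral_Fubini (fun z => Re (f z)) fr.
  by move=> x y D1x D2y; rewrite (le_trans (normr_Re_le _)) ?fg.
have [|ii ei] := @Rintegral_Fubini (fun z => Im (f z)) fi.
  by move=> x y D1x D2y; rewrite (le_trans (normr_Im_le _)) ?fg.
by split=> //; exact: complexP.
Qed.

End ComplexFubini.

(** * Derivatives of complex-valued functions of a real variable *)

Section ComplexDerivative.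
Context {R : realType}.
Implicit Types (x : R) (f g F : R -> R[i]) (l : R[i]).

Definition is_cderive x f l :=
  is_derive x 1 (fun t => Re (f t)) (Re l) /\
  is_derive x 1 (fun t => Im (f t)) (Im l).

Lemma is_cderive_eq x f l l' : is_cderive x f l -> l = l' -> is_cderive x f l'.
Proof. by move=> ? <-. Qed.

Lemma is_cderive_cst x l : is_cderive x (fun=> l) 0.
Proof. by split; exact: is_derive_cst. Qed.

Lemma is_cderive_real x (h : R -> R) (h' : R) :
  is_derive x 1 h h' -> is_cderive x (fun t => (h t)%:C) h'%:C.
Proof. by move=> dh; split => //=; exact: is_derive_cst. Qed.

Lemma is_cderiveD x f g l l' : is_cderive x f l -> is_cderive x g l' ->
  is_cderive x (fun t => f t + g t) (l + l').
Proof.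
move=> [fr fi] [gr gi]; split.
  by rewrite cReD; under eq_fun do rewrite cReD; exact: is_deriveD.
by rewrite cImD; under eq_fun do rewrite cImD; exact: is_deriveD.
Qed.

Lemma is_cderiveN x f l : is_cderive x f l -> is_cderive x (fun t => - f t) (- l).
Proof.
move=> [fr fi]; split.
  by rewrite cReN; under eq_fun do rewrite cReN; exact: is_deriveN.
by rewrite cImN; under eq_fun do rewrite cImN; exact: is_deriveN.
Qed.

Lemma is_cderiveM x f g l l' : is_cderive x f l -> is_cderive x g l' ->
  is_cderive x (fun t => f t * g t) (l * g x + f x * l').
Proof.
move=> [fr fi] [gr gi]; split.
  under eq_fun do rewrite cReM.
  apply: is_derive_eq.
  by rewrite cReD !cReM /GRing.scale/=; ring.
under eq_fun do rewrite cImM.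
apply: is_derive_eq.
by rewrite cImD !cImM /GRing.scale/=; ring.
Qed.

Lemma is_cderive_cexp x f l : is_cderive x f l ->
  is_cderive x (fun t => cexp (f t)) (l * cexp (f x)).
Proof.
move=> [fr fi]; split.
  under eq_fun do rewrite Re_cexp.
  apply: is_derive_eq.
  by rewrite cReM Re_cexp Im_cexp /GRing.scale/=; ring.
under eq_fun do rewrite Im_cexp.
apply: is_derive_eq.
by rewrite cImM Re_cexp Im_cexp /GRing.scale/=; ring.
Qed.

(** Differentiability of [f] supplies the continuity of the integrand that the fundamental theorem
    of calculus asks for. *)
Lemma cintegral_FTC (a b : R) F f : a < b ->
  (forall x, a <= x <= b -> is_cderive x F (f x)) ->
  (forall x, a <= x <= b -> exists l, is_cderive x f l) ->
  cintegral lebesgue_measure `[a, b] f = F b - F a.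
Proof.
move=> ab dF df.
have main (u v : R -> R) : (forall x, a <= x <= b -> is_derive x 1 u (v x)) ->
    (forall x, a <= x <= b -> derivable v x 1) ->
    \int[lebesgue_measure]_(x in `[a, b]) v x = u b - u a.
  move=> du dv.
  have cu x : a <= x <= b -> {for x, continuous u}.
    move=> /du dux; apply: differentiable_continuous; apply/derivable1_diffP.
    exact: ex_derive.
  rewrite /Rintegral (@continuous_FTC2 _ v u a b ab)//.
  - apply: derivable_within_continuous => x; rewrite in_itv/=; exact: dv.
  - split.
    + move=> x; rewrite in_itv/= => /andP[ax xb].
      by have := du x; rewrite !ltW// => /(_ isT)/@ex_derive.
    + by apply: cvg_at_right_filter; apply: cu; rewrite lexx ltW.
    + by apply: cvg_at_left_filter; apply: cu; rewrite lexx ltW.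
  - move=> x; rewrite in_itv/= => /andP[ax xb]; rewrite derive1E.
    by have := du x; rewrite !ltW// => /(_ isT)/@derive_val.
apply: complexP.
  rewrite cReD cReN; apply: (main (fun x => Re (F x)) (fun x => Re (f x))).
    by move=> x /dF[].
  by move=> x /df[l [/@ex_derive]].
rewrite cImD cImN; apply: (main (fun x => Im (F x)) (fun x => Im (f x))).
  by move=> x /dF[].
by move=> x /df[l [_ /@ex_derive]].
Qed.

(** The fundamental theorem holds on the exhausting intervals [E n]; dominated convergence passes to
    ]0, +oo[, and the limits of [F] at the two ends become the boundary values. *)
Lemma cintegral_FTC0y F f (h : R -> R) l0 ly : cmeasurable f ->
  (forall x, 0 < x -> is_cderive x F (f x)) ->
  (forall x, 0 < x -> exists l, is_cderive x f l) ->
  lebesgue_measure.-integrable `]0, +oo[ (fun x => (h x)%:E) ->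
  (forall x, 0 < x -> cmod (f x) <= h x) ->
  ccvg (fun n => F n.+2%:R^-1) l0 -> ccvg (fun n => F n.+2%:R) ly ->
  cintegral lebesgue_measure `]0, +oo[ f = ly - l0.
Proof.
move=> mf dF df ih fh F0 Fy.
(* With n + 2 rather than n + 1 the interval is nondegenerate already for n = 0. *)
pose E n : set R := `[n.+2%:R^-1, n.+2%:R]%classic.
have E0 n x : E n x -> 0 < x.
  by rewrite /E/= in_itv/= => /andP[+ _]; apply: lt_le_trans; rewrite invr_gt0 ltr0n.
apply: (@ccvg_unique _ (fun n => cintegral lebesgue_measure (E n) f)); last first.
  rewrite (_ : (fun n => _) = (fun n => F n.+2%:R - F n.+2%:R^-1)); first exact: ccvgB.
  apply/funext => n; apply: cintegral_FTC.
  - by rewrite (@lt_trans _ _ 1)// ?ltr1n// invf_lt1// ltr1n.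
  - by move=> x xE; apply: dF; apply: (E0 n); rewrite /E/= in_itv.
  - by move=> x xE; apply: df; apply: (E0 n); rewrite /E/= in_itv.
rewrite -cintegral_restrict.
under eq_fun do rewrite -cintegral_restrict.
apply: (@cintegral_dominated_cvg _ _ _ lebesgue_measure _ measurableT
  (fun n x => (\1_(E n) x)%:C * f x) (fun x => (\1_`]0, +oo[ x)%:C * f x)
  (h \_ `]0, +oo[)).
- by move=> n; apply: cmeasurable_restrict => //; exact: measurable_itv.
- exact: cmeasurable_restrict.
- by move/integrable_mkcond : ih; rewrite restrict_EFin; apply.
- move=> n x _; rewrite cmodM cmod_real indicE patchE.
  have [/set_mem xE|] := boolP (x \in E n); last first.
    rewrite normr0 mul0r; case: ifPn => // /set_mem; rewrite /= in_itv/= andbT => x0 _.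
    by rewrite (le_trans (cmod_ge0 (f x)))// fh.
  rewrite normr1 mul1r ifT; first exact/fh/(E0 n).
  by rewrite inE/= in_itv/= andbT (E0 n).
- move=> x _; have [x0|x0] := ltP 0 x; last first.
    apply: ccvg_near; near=> n; congr (_%:C * _); rewrite !indicE !memNset//.
      by rewrite /= in_itv/= andbT ltNge x0.
    by move=> /E0; rewrite ltNge x0.
  apply: ccvg_near; near=> n; congr (_%:C * _); rewrite !indicE !mem_set//.
    by rewrite /= in_itv/= andbT.
  (* Membership holds as soon as n is at least x and 1/x. *)
  rewrite /E/= in_itv/= invf_ple ?posrE ?ltr0n//; apply/andP; split.
    rewrite (@le_trans _ _ n%:R)// ?ler_nat//; last by rewrite leqW.
    near: n; exact: nbhs_infty_ger.
  rewrite (@le_trans _ _ n%:R)// ?ler_nat//; last by rewrite leqW.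
  near: n; exact: nbhs_infty_ger.
Unshelve. all: by end_near. Qed.

End ComplexDerivative.

(** * Integrability estimates and affine substitution on the real line *)

Lemma integrable_realZl {d : measure_display} {T : measurableType d} {R : realType}
    (m : {measure set T -> \bar R}) (D : set T) (c : R) (h : T -> R) : measurable D ->
  m.-integrable D (fun x => (h x)%:E) -> m.-integrable D (fun x => (c * h x)%:E).
Proof. by move=> mD ih; exact: (integrableZl mD c ih). Qed.

Section RealEstimates.
Context {R : realType}.
Local Notation mu := (@lebesgue_measure R).

(** From ln u <= u - 1 at u = (rho / a) y follows a ln y <= rho y - a - a ln (rho / a). The constant
    keeps the last term and drops e^(-a). *)
Lemma powR_le_expR (a rho : R) : 0 < a -> 0 < rho ->
  exists2 C : R, 0 <= C & forall y : R, 0 < y -> expR (a * ln y) <= C * expR (rho * y).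
Proof.
move=> a0 rho0; exists (expR (- (a * ln (rho / a)))); first exact: expR_ge0.
move=> y y0; rewrite -expRD ler_expR.
have c0 : 0 < rho / a by rewrite divr_gt0.
have cy0 : 0 < rho / a * y by rewrite mulr_gt0.
have : ln (1 + (rho / a * y - 1)) <= rho / a * y - 1.
  by apply: le_ln1Dx; rewrite ltrBrDl subrr.
rewrite addrCA subrr addr0 lnM ?posrE// => h.
have : a * (ln (rho / a) + ln y) <= a * (rho / a * y - 1) by rewrite ler_pM2l.
rewrite mulrBr mulr1 mulrA (mulrC a (rho / a)) divfK ?gt_eqF// mulrDr.
by lra.
Qed.

(** By evenness the integral is twice that over the positive half-line, where it equals [- F 0].
    Asking for the primitive only on x > 0 lets |x| be treated there as x. *)
Lemma integrable_even_FTC (f F : R -> R) : (forall x, 0 <= f x) -> continuous f ->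
  (forall x, f (- x) = f x) -> F x @[x --> +oo] --> 0 ->
  (forall x : R, 0 < x -> is_derive x 1 F (f x)) -> F x @[x --> 0^'+] --> F 0 ->
  mu.-integrable setT (fun x => (f x)%:E).
Proof.
move=> f0 cf fN Fy dF F0; apply/integrableP; split.
  by apply/measurable_EFinP; apply: continuous_measurable_fun.
under eq_integral do rewrite gee0_abs ?lee_fin//.
rewrite ge0_symfun_integralT//; last by move=> x; rewrite /= fN.
rewrite -set_itvcy (@ge0_continuous_FTC2y _ f F 0 0)//.
- by rewrite -EFinB -EFinM ltry.
- exact: continuous_subspaceT.
- by move=> x /dF/@ex_derive.
- by move=> x; rewrite in_itv/= andbT => x0; rewrite derive1E; have /@derive_val := dF _ x0.
Qed.

Lemma integrable_expRN_norm (e : R) : 0 < e ->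
  mu.-integrable setT (fun x => (expR (- (e * `|x|)))%:E).
Proof.
move=> e0.
have cf : continuous (fun x : R => expR (- (e * `|x|))).
  move=> x; apply: continuous_comp; last exact: continuous_expR.
  apply: cvgN; apply: cvgM; [exact: cvg_cst|exact: norm_continuous].
apply: (@integrable_even_FTC _ (fun x => - e^-1 * expR (- (e * x)))).
- by move=> x; exact: expR_ge0.
- exact: cf.
- by move=> x; rewrite normrN.
- rewrite -[X in _ --> X](mulr0 (- e^-1)); apply: cvgM; first exact: cvg_cst.
  apply: (cvg_comp (fun x => e * x) (fun x => expR (- x))); last exact: cvgr_expR.
  by apply: gt0_cvgMry => //; exact: cvg_id.
- move=> x x0; apply: is_derive_eq.
  rewrite (gtr0_norm x0) /GRing.scale/=; field; by rewrite gt_eqF.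
- apply: cvg_at_right_filter; apply: cvgM; first exact: cvg_cst.
  apply: continuous_comp; last exact: continuous_expR.
  apply: cvgN; apply: cvgM; [exact: cvg_cst|exact: cvg_id].
Qed.

Lemma cvgry_ln : ln x @[x --> +oo] --> (+oo : set_system R).
Proof.
apply/cvgryPge => A; near=> x.
have Ax : expR A <= x by near: x; exact: nbhs_pinfty_ge.
by rewrite -[A]expRK ler_ln ?posrE ?expR_gt0// (lt_le_trans _ Ax)// expR_gt0.
Unshelve. all: by end_near. Qed.

(** This is the decay of |w|^-(Re r + 1) along Re w = s, with a = Re r. On x > 0 a primitive is - (s
    + x)^(-a) / a. *)
Lemma integrable_powRN_norm (s a : R) : 0 < s -> 0 < a ->
  mu.-integrable setT (fun x => (expR (- ((a + 1) * ln (s + `|x|))))%:E).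
Proof.
move=> s0 a0.
have sx0 (x : R) : 0 < s + `|x| by rewrite ltr_pwDl.
have cf : continuous (fun x : R => expR (- ((a + 1) * ln (s + `|x|)))).
  move=> x; apply: continuous_comp; last exact: continuous_expR.
  apply: cvgN; apply: cvgM; first exact: cvg_cst.
  apply: continuous_comp; last exact: continuous_ln.
  apply: cvgD; [exact: cvg_cst|exact: norm_continuous].
apply: (@integrable_even_FTC _ (fun x => - a^-1 * expR (- (a * ln (s + x))))).
- by move=> x; exact: expR_ge0.
- exact: cf.
- by move=> x; rewrite normrN.
- rewrite -[X in _ --> X](mulr0 (- a^-1)); apply: cvgM; first exact: cvg_cst.
  apply: (cvg_comp (fun x => a * ln (s + x)) (fun x => expR (- x))); last exact: cvgr_expR.
  apply: gt0_cvgMry => //.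
  apply: (cvg_comp (fun x => s + x) (@ln R)); first exact: cvg_addrl.
  exact: cvgry_ln.
- move=> x x0; have sx : 0 < s + x by rewrite addr_gt0.
  have dl := is_derive1_ln sx.
  apply: is_derive_eq.
  rewrite (gtr0_norm x0) /GRing.scale/=.
  rewrite mulrDl opprD expRD mul1r [expR (- ln _)]expRN lnK ?posrE//.
  field; by rewrite !gt_eqF.
- apply: cvg_at_right_filter; apply: cvgM; first exact: cvg_cst.
  apply: continuous_comp; last exact: continuous_expR.
  apply: cvgN; apply: cvgM; first exact: cvg_cst.
  apply: continuous_comp; last by apply: continuous_ln; rewrite addr0.
  apply: cvgD; [exact: cvg_cst|exact: cvg_id].
Qed.

Lemma integral_oneDsqrV : (\int[mu]_x ((1 + x ^+ 2)^-1)%:E = pi%:E)%E.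
Proof.
rewrite (@ge0_symfun_integralT _ (fun x : R => (1 + x ^+ 2)^-1)).
- by rewrite -set_itvcy integral0y_oneDsqr -EFinM mulrCA divff ?mulr1.
- by move=> x; rewrite invr_ge0 addr_ge0 ?sqr_ge0.
- exact: continuous_oneDsqrV.
- by move=> x /=; rewrite sqrrN.
Qed.

Lemma integrable_oneDsqrV : mu.-integrable setT (fun x => ((1 + x ^+ 2)^-1)%:E).
Proof.
apply/integrableP; split.
  by apply/measurable_EFinP; apply: continuous_measurable_fun; exact: continuous_oneDsqrV.
under eq_integral do rewrite gee0_abs ?lee_fin ?invr_ge0 ?addr_ge0 ?sqr_ge0//.
by rewrite integral_oneDsqrV ltry.
Qed.

(** Lebesgue measure is c times its image under u -> x + c u; by uniqueness it is enough to check
    this on half-open intervals. *)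
Lemma ge0_integral_affine (c x : R) (f : R -> \bar R) : 0 < c ->
  measurable_fun setT f -> (forall y, 0 <= f y)%E ->
  (\int[mu]_y f y = c%:E * \int[mu]_u f (x + c * u)%R)%E.
Proof.
move=> c0 mf f0.
have mphi : measurable_fun setT ((fun u => x + c * u) : R -> measurableTypeR R).
  by apply: measurable_funD => //; exact: measurable_funM.
rewrite (eq_measure_integral (mscale (NngNum (ltW c0))
  (pushforward mu ((fun u => x + c * u) : R -> measurableTypeR R)))).
  by rewrite ge0_integral_mscale//= ge0_integral_pushforward.
move=> A mA _; apply: lebesgue_measure_unique => //= _ [[a b]] _ <-.
rewrite /mscale/= /pushforward.
rewrite (_ : _ @^-1` _ = `](c^-1 * (a - x)), (c^-1 * (b - x))]%classic); last first.
  apply/seteqP; split=> u /=; rewrite !in_itv/= ltr_pdivrMl// ler_pdivlMl//;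
  by rewrite ltrBlDl lerBrDl.
rewrite !lebesgue_measure_itv/= !lte_fin ltr_pM2l ?invr_gt0// ltrD2r.
case: ifPn => _; last by rewrite mule0.
by rewrite -!EFinB -EFinM; congr (_%:E); field; rewrite gt_eqF.
Qed.

Lemma Rintegral_affine (c x : R) (f : R -> R) : 0 < c ->
  mu.-integrable setT (fun y => (f y)%:E) ->
  \int[mu]_y f y = c * \int[mu]_u f (x + c * u).
Proof.
move=> c0 intf; have mf := measurable_int _ intf.
have posE (g : R -> \bar R) : measurable_fun setT g -> (forall y, 0 <= g y)%E ->
    (\int[mu]_y g y < +oo)%E ->
    (\int[mu]_u g (x + c * u)%R < +oo)%E /\
    fine (\int[mu]_y g y) = c * fine (\int[mu]_u g (x + c * u)%R).
  move=> mg g0 ig; have gE := ge0_integral_affine x c0 mg g0.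
  (* An infinite integral on the right would make the left one infinite, since c > 0. *)
  have fg : (\int[mu]_u g (x + c * u)%R < +oo)%E.
    move: ig; rewrite gE.
    have := integral_ge0 mu (D := setT) (f := fun u => g (x + c * u)) (fun u _ => g0 _).
    case: (\int[mu]_u g (x + c * u)%R)%E => [k|//|//] _; first by move=> _; exact: ltry.
    by rewrite gt0_muley// lte_fin.
  by split=> //; rewrite gE fineM// ge0_fin_numE//; exact: integral_ge0.
have [ip ep] := posE _ (measurable_funepos mf) (funepos_ge0 _)
  (integral_funepos_lt_pinfty measurableT intf).
have [im em] := posE _ (measurable_funeneg mf) (funeneg_ge0 _)
  (integral_funeneg_lt_pinfty measurableT intf).
have fE (g : R -> \bar R) : (\int[mu]_y g^\+ y < +oo)%E -> (\int[mu]_y g^\- y < +oo)%E ->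
    fine (\int[mu]_y g y) = fine (\int[mu]_y g^\+ y) - fine (\int[mu]_y g^\- y).
  by move=> gp gm; rewrite [in LHS]integralE fineB// ge0_fin_numE ?integral_ge0.
rewrite /Rintegral (fE _ (integral_funepos_lt_pinfty measurableT intf)
  (integral_funeneg_lt_pinfty measurableT intf)).
have := fE ((fun y => (f y)%:E) \o (fun u => x + c * u)).
rewrite funepos_comp funeneg_comp => /(_ ip im) ->.
by rewrite mulrBr ep em.
Qed.

Lemma integrable_affine (c x : R) (f : R -> R) : 0 < c ->
  mu.-integrable setT (fun y => (f y)%:E) ->
  mu.-integrable setT (fun u => (f (x + c * u))%:E).
Proof.
move=> c0 /integrableP[mf]; rewrite (ge0_integral_affine x c0); last 2 first.
- exact: measurableT_comp.
- by [].
move=> ic; apply/integrableP; split.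
  apply/measurable_EFinP; apply: measurableT_comp; first exact/measurable_EFinP.
  by apply: measurable_funD => //; exact: measurable_funM.
move: ic.
have := integral_ge0 mu (D := setT) (f := fun u => `|(f (x + c * u))%:E|%E)
  (fun u _ => abse_ge0 _).
case: (\int[mu]_u `|(f (x + c * u))%:E|)%E => [k|//|//] _; first by move=> _; exact: ltry.
by rewrite gt0_muley// lte_fin.
Qed.

(** Lebesgue measure is invariant under negation, and the point 0 left in the complement of ]0, +oo[
    is a null set. *)
Lemma Rintegral_opp_itv (f : R -> R) : mu.-integrable setT (fun y => (f y)%:E) ->
  mu.-integrable `]0, +oo[ (fun y => (f (- y))%:E) ->
  \int[mu]_y f y = \int[mu]_(y in `]0, +oo[) f y + \int[mu]_(y in `]0, +oo[) f (- y).
Proof.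
move=> intf intfN.
have preE : (-%R : R -> R) @^-1` `]-oo, 0[ = `]0, +oo[%classic.
  by apply/seteqP; split=> y /=; rewrite !in_itv/= ?andbT oppr_lt0.
have -> : \int[mu]_(y in `]0, +oo[) f (- y) = \int[mu]_(y in `]-oo, 0[) f y.
  congr fine; transitivity (\int[pushforward mu (-%R : _ -> measurableTypeR R)]_(y in
    `]-oo, 0%R[) (f y)%:E)%E.
    rewrite integral_pushforward//.
    - by rewrite preE.
    - exact: measurable_int intf.
    - by rewrite preE.
  by apply: eq_measure_integral => A mA _; exact: lebesgue_measureN.
rewrite -(setUv `]0, +oo[%classic) Rintegral_setU//.
- rewrite setCitvr Rintegral_itv_bndo_bndc//.
  exact: integrableS intf.
- exact: measurableC.
- by rewrite setUv.
- exact/disj_setPCl.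
Qed.

End RealEstimates.

(** * Euler's integral along a ray of the right half-plane *)

Lemma cvg_invSS (R : realType) : n.+2%:R^-1 @[n --> \oo] --> (0 : R).
Proof. by rewrite (cvg_shiftS (@harmonic R)); exact: cvg_harmonic. Qed.

Section GammaIntegral.
Context {R : realType}.
Local Notation mu := (@lebesgue_measure R).
Variables (r zeta : R[i]).
Hypotheses (r0 : 0 < Re r) (zeta_lt : `|Im zeta| < pi / 2).

Let W (s : R) : R[i] := cexp (s%:C * zeta).

(* At [s = 0] this is the integrand of Gamma(r + 1); at [s = 1] it is
   w^(r+1) y^r e^(-w y) for [w = cexp zeta]. *)
Let k (s y : R) : R[i] :=
  cexp ((r + 1) * (s%:C * zeta) + r * (ln y)%:C - W s * y%:C).

(** A lower bound for Re (W s) on [0, 1]: the modulus e^(s Re zeta) is at least e^(-|zeta|), and the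
    cosine of the argument s Im zeta is at least that of Im zeta. *)
Let rho : R := expR (- cmod zeta) * cos (Im zeta).

Let rho_gt0 : 0 < rho.
Proof. by rewrite mulr_gt0 ?expR_gt0// cos_gt0_pihalf// -ltr_norml. Qed.

Let Re_W_ge s : 0 <= s <= 1 -> rho <= Re (W s).
Proof.
move=> /andP[s0 s1]; rewrite /W Re_cexp cReM cImM/= !mul0r subr0 addr0.
(* [cos] is even and strictly decreasing on [0, pi]; the case of equal absolute values is set
   apart. *)
have cz : cos (Im zeta) <= cos (s * Im zeta).
  have cosE (u : R) : cos u = cos `|u|.
    by have [u0|u0] := leP 0 u; rewrite ?(ger0_norm u0)// (ltr0_norm u0) cosN.
  have pi2 : pi / 2 <= pi :> R by rewrite ler_pdivrMr// ler_peMr ?pi_ge0 ?ler1n.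
  have ss : `|s * Im zeta| <= `|Im zeta| by rewrite normrM (ger0_norm s0) ler_piMl.
  rewrite cosE (cosE (s * _)) le_eqVlt; have [->|ne] := eqVneq `|Im zeta| `|s * Im zeta|.
    by rewrite eqxx.
  apply/orP; right; rewrite ltr_cos ?in_itv/= ?normr_ge0/=.
  - by rewrite lt_neqAle eq_sym ne.
  - by rewrite (le_trans ss)// (le_trans (ltW zeta_lt)).
  - by rewrite (le_trans (ltW zeta_lt)).
have cz0 : 0 <= cos (Im zeta) by rewrite cos_ge0_pihalf// -ler_norml ltW.
apply: ler_pM => //.
rewrite ler_expR lerNl (le_trans _ (normr_Re_le zeta))//.
by rewrite (le_trans (ler_norm _))// normrN normrM (ger0_norm s0) ler_piMl.
Qed.

Let cmod_W_le s : 0 <= s <= 1 -> cmod (W s) <= expR (cmod zeta).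
Proof.
move=> /andP[s0 s1]; rewrite /W cmod_cexp cReM/= mul0r subr0 ler_expR.
rewrite (le_trans _ (normr_Re_le zeta))// (le_trans (ler_norm _))//.
by rewrite normrM (ger0_norm s0) ler_piMl.
Qed.

(** Half of the rate [rho] absorbs the powers of y with exponents Re r, Re r + 1 and Re r + 2. The
    first bound gives the integrability of k and the vanishing of y k at 0, the second helps to
    control [dk], the third makes y k vanish at infinity. *)
Let k_bound : exists2 C : R, 0 <= C & forall s y, 0 <= s <= 1 -> 0 < y ->
  [/\ cmod (k s y) <= C * expR (- (rho / 2 * `|y|)),
      y * cmod (k s y) <= C * expR (- (rho / 2 * `|y|)) &
      y ^+ 2 * cmod (k s y) <= C * expR (- (rho / 2 * `|y|))].
Proof.
(* [M] bounds the factor e^((r+1) s zeta) for all s in [0, 1]. *)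
pose a := Re r; pose M := expR (cmod (r + 1) * cmod zeta).
have kM s y : 0 <= s <= 1 -> 0 < y ->
    cmod (k s y) <= M * (expR (a * ln y) * expR (- (rho * y))).
  move=> s01 y0; rewrite /k /M cmod_cexp -!expRD ler_expR !cReD cReN.
  rewrite [Re (r * _)]cReM [Re (W s * _)]cReM/= !mulr0 !subr0 addrA.
  apply: lerD; last by rewrite lerN2 ler_wpM2r ?Re_W_ge// ltW.
  rewrite lerD2r (le_trans (ler_norm _))// (le_trans (normr_Re_le _))//.
  rewrite cmodM ler_wpM2l ?cmod_ge0//.
  by case/andP: s01 => s0 s1; rewrite cmodM cmod_real (ger0_norm s0) ler_piMl ?cmod_ge0.
have rho2 : 0 < rho / 2 by rewrite divr_gt0.
have pw b : 0 < b -> exists2 C : R, 0 <= C & forall y, 0 < y ->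
    expR (b * ln y) * expR (- (rho * y)) <= C * expR (- (rho / 2 * y)).
  move=> b0; have [C C0 hC] := powR_le_expR b0 rho2; exists C => // y y0.
  rewrite (_ : - (rho / 2 * y) = rho / 2 * y - rho * y); last by field.
  by rewrite expRD mulrA ler_wpM2r ?expR_ge0 ?hC.
have [C0 C00 h0] := pw _ r0.
have [C1 C10 h1] := pw (a + 1) (addr_gt0 r0 ltr01).
have [C2 C20 h2] := pw (a + 2) (addr_gt0 r0 (ltr0Sn _ 1)).
have M0 : 0 <= M by exact: expR_ge0.
exists (M * (C0 + C1 + C2)); first by rewrite mulr_ge0// !addr_ge0.
move=> s y s01 y0; have y00 := ltW y0; rewrite (gtr0_norm y0).
have lnyK : expR (ln y) = y by rewrite lnK ?posrE.
have aux (p c : R) : 0 <= p ->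
    p * (expR (a * ln y) * expR (- (rho * y))) <= c * expR (- (rho / 2 * y)) ->
    c <= C0 + C1 + C2 ->
    p * cmod (k s y) <= M * (C0 + C1 + C2) * expR (- (rho / 2 * y)).
  move=> p0 hp hc; rewrite (le_trans (ler_wpM2l p0 (kM _ _ s01 y0)))//.
  rewrite mulrCA -mulrA ler_wpM2l// (le_trans hp)// ler_wpM2r ?expR_ge0//.
split.
- rewrite -[leLHS]mul1r; apply: (aux 1 C0) => //; first by rewrite mul1r; exact: h0.
  by rewrite -addrA lerDl addr_ge0.
- apply: (aux y C1) => //; last by rewrite -addrA addrCA lerDl addr_ge0.
  by rewrite mulrA -{1}lnyK -expRD addrC -[X in _ + X]mul1r -mulrDl; exact: h1.
- apply: (aux (y ^+ 2) C2) => //; last by rewrite lerDr addr_ge0.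
    by rewrite sqr_ge0.
  rewrite mulrA -{1}lnyK -expRM_natl -expRD addrC -mulrDl; exact: h2.
Qed.

(** The y-derivative of y k is [dk], and the s-derivative of k is zeta times [dk]; this coincidence
    drives the whole section. *)
Let dk (s y : R) : R[i] := (r + 1 - W s * y%:C) * k s y.

Let cmeasurable_dk : cmeasurable (fun z : R * R => dk z.1 z.2).
Proof.
have m1 : cmeasurable (fun z : R * R => z.1%:C).
  by apply: cmeasurable_real; exact: measurable_fst.
have m2 : cmeasurable (fun z : R * R => z.2%:C).
  by apply: cmeasurable_real; exact: measurable_snd.
have ml : cmeasurable (fun z : R * R => (ln z.2)%:C).
  by apply: cmeasurable_real; apply: measurableT_comp => //; exact: measurable_ln.
have mW : cmeasurable (fun z : R * R => W z.1).
  by apply: cmeasurable_cexp; apply: cmeasurableM => //; exact: cmeasurable_cst.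
have mWy : cmeasurable (fun z : R * R => - (W z.1 * z.2%:C)).
  by apply: cmeasurableN; exact: cmeasurableM.
apply: cmeasurableM.
  by apply: cmeasurableD => //; exact: cmeasurable_cst.
apply: cmeasurable_cexp; apply: cmeasurableD => //; apply: cmeasurableD.
  apply: cmeasurableM; first exact: cmeasurable_cst.
  by apply: cmeasurableM => //; exact: cmeasurable_cst.
by apply: cmeasurableM => //; exact: cmeasurable_cst.
Qed.

Let cmeasurable_k s : cmeasurable (k s).
Proof.
apply: cmeasurable_cexp; apply: cmeasurableD; first apply: cmeasurableD.
- exact: cmeasurable_cst.
- apply: cmeasurableM; first exact: cmeasurable_cst.
  by apply: cmeasurable_real; exact: measurable_ln.
- apply: cmeasurableN; apply: cmeasurableM; first exact: cmeasurable_cst.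
  by apply: cmeasurable_real; exact: measurable_id.
Qed.

Let cmeasurable_dk_y s : cmeasurable (dk s).
Proof.
apply: cmeasurableM; last exact: cmeasurable_k.
apply: cmeasurableD; first exact: cmeasurable_cst.
apply: cmeasurableN; apply: cmeasurableM; first exact: cmeasurable_cst.
by apply: cmeasurable_real; exact: measurable_id.
Qed.

Let dW s : is_cderive s W (zeta * W s).
Proof.
apply: is_cderive_cexp; apply: is_cderive_eq.
  apply: is_cderiveM; last exact: is_cderive_cst.
  exact: is_cderive_real.
by rewrite mulr0 addr0 mul1r.
Qed.

Let dk_s s y : is_cderive s (k ^~ y) (zeta * dk s y).
Proof.
apply: is_cderive_eq.
  apply: is_cderive_cexp; apply: is_cderiveD; first apply: is_cderiveD.
  - apply: is_cderiveM; first exact: is_cderive_cst.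
    apply: is_cderiveM; last exact: is_cderive_cst.
    exact: is_cderive_real.
  - exact: is_cderive_cst.
  - apply: is_cderiveN; apply: is_cderiveM; last exact: is_cderive_cst.
    exact: dW.
by rewrite /dk -/(k s y); ring.
Qed.

Let ddk_s s y : exists l, is_cderive s (fun s => zeta * dk s y) l.
Proof.
eexists; apply: is_cderiveM; first exact: is_cderive_cst.
apply: is_cderiveM; last exact: dk_s.
apply: is_cderiveD; first exact: is_cderive_cst.
apply: is_cderiveN; apply: is_cderiveM; last exact: is_cderive_cst.
exact: dW.
Qed.

Let dk_y s y : 0 < y -> is_cderive y (k s) ((r * (y^-1)%:C - W s) * k s y).
Proof.
move=> y0; apply: is_cderive_eq.
  apply: is_cderive_cexp; apply: is_cderiveD; first apply: is_cderiveD.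
  - exact: is_cderive_cst.
  - apply: is_cderiveM; first exact: is_cderive_cst.
    apply: is_cderive_real; exact: is_derive1_ln.
  - apply: is_cderiveN; apply: is_cderiveM; first exact: is_cderive_cst.
    exact: is_cderive_real.
by rewrite -/(k s y) !mul0r !add0r mulr1.
Qed.

Let dyk_y s y : 0 < y -> is_cderive y (fun y => y%:C * k s y) (dk s y).
Proof.
move=> y0; apply: is_cderive_eq.
  by apply: is_cderiveM; [exact: is_cderive_real|exact: dk_y].
rewrite /dk mulrA -mulrDl; congr (_ * _); rewrite mulrBr mulrCA -rmorphM/= divff ?gt_eqF//.
by rewrite mulr1; ring.
Qed.

Let ddk_y s y : 0 < y -> exists l, is_cderive y (dk s) l.
Proof.
move=> y0; eexists; apply: is_cderiveM; last exact: dk_y.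
apply: is_cderiveD; first exact: is_cderive_cst.
apply: is_cderiveN; apply: is_cderiveM; first exact: is_cderive_cst.
exact: is_cderive_real.
Qed.

Let integrable_bound (C : R) :
  mu.-integrable `]0, +oo[ (fun y => (C * expR (- (rho / 2 * `|y|)))%:E).
Proof.
apply: integrable_realZl; first exact: measurable_itv.
apply: (@integrableS _ _ _ mu setT) => //.
by apply: integrable_expRN_norm; rewrite divr_gt0.
Qed.

Let dk_bound : exists C : R, forall s y, 0 <= s <= 1 -> 0 < y ->
  cmod (dk s y) <= C * expR (- (rho / 2 * `|y|)).
Proof.
have [C C0 hC] := k_bound.
exists (cmod (r + 1) * C + expR (cmod zeta) * C) => s y s01 y0.
have [h0 h1 _] := hC _ _ s01 y0.
rewrite /dk mulrBl (le_trans (le_cmodD _ _))// cmodN.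
rewrite (cmodM (r + 1)) (cmodM (W s * _)) (cmodM (W s)) mulrDl; apply: lerD.
  by rewrite -mulrA ler_wpM2l ?cmod_ge0.
rewrite cmod_real [in leLHS](gtr0_norm y0) -mulrA -[leRHS]mulrA; apply: ler_pM => //.
- exact: cmod_ge0.
- by rewrite mulr_ge0 ?cmod_ge0// ltW.
- exact: cmod_W_le.
Qed.

(** [dk s] is the derivative of y k(s, y), which tends to 0 at both ends of ]0, +oo[. *)
Let integral_dk s : 0 <= s <= 1 -> cintegral mu `]0, +oo[ (dk s) = 0.
Proof.
move=> s01; have [C hC] := dk_bound; have [D D0 hD] := k_bound.
have D1 y : 0 < y -> D * expR (- (rho / 2 * `|y|)) <= D.
  by move=> y0; rewrite ler_piMr// -expR0 ler_expR oppr_le0 mulr_ge0// ?divr_ge0// ltW.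
rewrite -[RHS]subr0.
apply: (@cintegral_FTC0y _ (fun y => y%:C * k s y) _
  (fun y => C * expR (- (rho / 2 * `|y|)))).
- exact: cmeasurable_dk_y.
- by move=> y; exact: dyk_y.
- by move=> y; exact: ddk_y.
- exact: integrable_bound.
- by move=> y y0; exact: hC.
(* Near 0, k is bounded by D and the factor y tends to 0. *)
- apply: (@ccvg_squeeze _ _ _ (fun n => D * n.+2%:R^-1)).
    apply: nearW => n; rewrite subr0 cmodM cmod_real ger0_norm ?invr_ge0//.
    have y0 : 0 < n.+2%:R^-1 :> R by rewrite invr_gt0.
    have [h0 _ _] := hD _ _ s01 y0.
    by rewrite mulrC ler_wpM2r ?invr_ge0// (le_trans h0)// D1.
  rewrite -[X in _ --> X](mulr0 D); apply: cvgM; first exact: cvg_cst.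
  exact: cvg_invSS.
(* At infinity, y^2 |k| <= D gives y |k| <= D / y. *)
- apply: (@ccvg_squeeze _ _ _ (fun n => D * n.+2%:R^-1)).
    apply: nearW => n; rewrite subr0 cmodM cmod_real ger0_norm//.
    have y0 : 0 < n.+2%:R :> R by [].
    have [_ _ h2] := hD _ _ s01 y0.
    by rewrite ler_pdivlMr// mulrAC -expr2 (le_trans h2)// D1.
  rewrite -[X in _ --> X](mulr0 D); apply: cvgM; first exact: cvg_cst.
  exact: cvg_invSS.
Qed.

(** The right-hand side is Gamma(r+1) / w^(r+1) for w = e^zeta. Rather than differentiating under
    the integral sign, the proof writes k(1, y) - k(0, y) as an integral over s in [0, 1] and
    exchanges the two integrals. *)
Lemma cintegral_Gamma_cexp :
  cintegral mu `]0, +oo[ (fun y => cexp (r * (ln y)%:C - cexp zeta * y%:C)) =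
  cGamma (r + 1) * cexp (- ((r + 1) * zeta)).
Proof.
have [C hC] := dk_bound; have [D D0 hD] := k_bound.
have ik s : 0 <= s <= 1 -> cintegrable mu `]0, +oo[ (k s).
  move=> s01.
  apply: (@cintegrable_dominated _ _ _ mu _ _ _ (fun y => D * expR (- (rho / 2 * `|y|)))) => //.
    exact: cmeasurable_k.
  by move=> y; rewrite /= in_itv/= andbT => y0; have [] := hD _ _ s01 y0.
have k0 : cintegral mu `]0, +oo[ (k 0) = cGamma (r + 1).
  apply: eq_cintegral => y; rewrite /= in_itv/= andbT => y0.
  rewrite cpow_real// addrK -cexp_real -cexpD rmorphN/=; congr cexp.
  by rewrite /W !mul0r cexp0 mulr0 add0r mul1r.
have k1 : cintegral mu `]0, +oo[ (k 1) = cexp ((r + 1) * zeta) *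
    cintegral mu `]0, +oo[ (fun y => cexp (r * (ln y)%:C - cexp zeta * y%:C)).
  have kE y : k 1 y = cexp ((r + 1) * zeta) * cexp (r * (ln y)%:C - cexp zeta * y%:C).
    by rewrite /k /W mul1r -addrA cexpD.
  rewrite -cintegralZ//; first by apply: eq_cintegral => y _; exact: kE.
  apply: (@eq_cintegrable _ _ _ mu _ _ (fun y => cexp (- ((r + 1) * zeta)) * k 1 y)) => //.
    by move=> y _; rewrite kE mulrA -cexpD addNr cexp0 mul1r.
  by apply: cintegrableZ => //; apply: ik; rewrite ler01 lexx.
suff : cintegral mu `]0, +oo[ (k 1) - cintegral mu `]0, +oo[ (k 0) = 0.
  move/eqP; rewrite subr_eq0 k0 k1 => /eqP <-.
  by rewrite mulrAC -cexpD subrr cexp0 mul1r.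
have ik0 : cintegrable mu `]0, +oo[ (k 0) by apply: ik; rewrite lexx ler01.
have ik1 : cintegrable mu `]0, +oo[ (k 1) by apply: ik; rewrite ler01 lexx.
rewrite -mulN1r -cintegralZ// -cintegralD//; last exact: cintegrableZ.
have -> : cintegral mu `]0, +oo[ (fun y => k 1 y + -1 * k 0 y) =
    cintegral mu `]0, +oo[ (fun y => cintegral mu `[0, 1] (fun s => zeta * dk s y)).
  apply: eq_cintegral => y _; rewrite mulN1r.
  by rewrite (@cintegral_FTC _ 0 1 (k ^~ y))//; exact: ddk_s.
have m01 : mu.-integrable `[0, 1] (fun=> (1 : R)%:E).
  apply: (@continuous_compact_integrable _ (fun=> 1)); first exact: segment_compact.
  by apply: continuous_subspaceT => x; exact: cvg_cst.
have [//|//|||_ <-] := @cintegral_Fubini _ _ _ _ R mu mu `[0, 1] `]0, +oo[ (fun=> 1)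
  (fun y => cmod zeta * C * expR (- (rho / 2 * `|y|))) _ _ m01 (integrable_bound _)
  (fun z => zeta * dk z.1 z.2) _ _.
- by apply: cmeasurableM => //; exact: cmeasurable_cst.
- move=> s y /=; rewrite !in_itv/= andbT => s01 y0.
  by rewrite mul1r cmodM -mulrA ler_wpM2l ?cmod_ge0// hC.
(* After the exchange the inner integral is zeta times that of [dk s], hence 0. *)
rewrite (@eq_cintegral _ _ _ _ _ _ (fun=> 0)); last first.
  move=> s /=; rewrite in_itv/= => s01; rewrite cintegralZ ?integral_dk ?mulr0//.
  apply: (@cintegrable_dominated _ _ _ mu _ _ _ (fun y => C * expR (- (rho / 2 * `|y|)))) => //.
  - exact: cmeasurable_dk_y.
  -
  by move=> y; rewrite /= in_itv/= andbT; exact: hC.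
by apply: complexP; rewrite /= Rintegral_cst ?mul0r.
Qed.

End GammaIntegral.

(** * The Poisson kernel *)

Section PoissonKernel.
Context {R : realType}.
Local Notation mu := (@lebesgue_measure R).

Lemma cintegral_cexp0y (c : R[i]) : Re c < 0 ->
  cintegral mu `]0, +oo[ (fun t => cexp (t%:C * c)) = - c^-1.
Proof.
move=> c0; have cN0 : c != 0 by apply: contraTneq c0 => ->; rewrite ltxx.
have e0 : 0 < - Re c by rewrite oppr_gt0.
have dE t : is_cderive t (fun t => cexp (t%:C * c)) (c * cexp (t%:C * c)).
  apply: is_cderive_eq.
    apply: is_cderive_cexp; apply: is_cderiveM; last exact: is_cderive_cst.
    exact: is_cderive_real.
  by rewrite mulr0 addr0 mul1r.
have modE t : cmod (cexp (t%:C * c)) = expR (t * Re c).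
  by rewrite cmod_cexp cReM/= mul0r subr0.
rewrite -[RHS]add0r.
apply: (@cintegral_FTC0y _ (fun t => c^-1 * cexp (t%:C * c)) _
  (fun t => expR (- (- Re c * `|t|)))).
- apply: cmeasurable_cexp; apply: cmeasurableM; last exact: cmeasurable_cst.
  by apply: cmeasurable_real; exact: measurable_id.
- move=> t _; apply: is_cderive_eq.
    by apply: is_cderiveM; [exact: is_cderive_cst|exact: dE].
  by rewrite mul0r add0r mulrA mulVf// mul1r.
- by move=> t _; exists (c * cexp (t%:C * c)).
- apply: (@integrableS _ _ _ mu setT) => //.
  exact: integrable_expRN_norm.
- by move=> t t0; rewrite modE (gtr0_norm t0) mulNr opprK mulrC.
- rewrite -[X in ccvg _ X]mulr1; apply: ccvgM; first exact: ccvg_cst.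
  rewrite -cexp0 -[X in ccvg _ (cexp X)](mul0r c); apply: ccvg_cexp.
  apply: ccvgM; last exact: ccvg_cst.
  by apply: ccvg_real; exact: cvg_invSS.
(* With a = - Re c > 0, the bound e^(-a y) <= 1 / (a y) comes from 1 + u <= e^u. *)
- apply: (@ccvg_squeeze _ _ _ (fun n => cmod c^-1 * (- Re c)^-1 * n.+2%:R^-1)).
    apply: nearW => n; rewrite subr0 (cmodM c^-1) modE -mulrA ler_wpM2l ?cmod_ge0//.
    rewrite -invfM -[X in expR X]opprK -mulrN expRN lef_pV2 ?posrE ?expR_gt0 ?mulr_gt0//.
    by rewrite [leLHS]mulrC (le_trans _ (expR_ge1Dx _))// lerDr.
  rewrite -[X in _ --> X](mulr0 (cmod c^-1 * (- Re c)^-1)).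
  by apply: cvgM; [exact: cvg_cst|exact: cvg_invSS].
Qed.

(* The Abel factor e^(-e|t|) times e^(ist); its integral in [t] is the Poisson kernel. *)
Definition poisson (e s t : R) : R[i] := cexp ((- (e * `|t|)) +i* (t * s)).

Lemma cmod_poisson e s t : cmod (poisson e s t) = expR (- (e * `|t|)).
Proof. by rewrite cmod_cexp. Qed.

Lemma cmeasurable_poisson e s : cmeasurable (poisson e s).
Proof.
apply: cmeasurable_cexp; apply: cmeasurable_pair.
  by apply: measurableT_comp => //; exact: measurable_funM.
exact: measurable_funM.
Qed.

Lemma cintegrable_poisson e s : 0 < e -> cintegrable mu setT (poisson e s).
Proof.
move=> e0; apply: (@cintegrable_dominated _ _ _ mu _ _ _ (fun t => expR (- (e * `|t|)))) => //.
- exact: cmeasurable_poisson.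
- exact: integrable_expRN_norm.
- by move=> t _; rewrite cmod_poisson.
Qed.

(** Folding the line at 0 leaves two exponential integrals with the conjugate rates -e + i s and -e
    - i s; the values -1/c add up to the Poisson kernel. *)
Lemma cintegral_poisson e s : 0 < e ->
  cintegral mu setT (poisson e s) = (2 * e / (e ^+ 2 + s ^+ 2))%:C.
Proof.
move=> e0; have [ir ii] := cintegrable_poisson s e0.
have [] : cintegrable mu `]0, +oo[ (fun t => poisson e s (- t)).
  apply: (@cintegrable_dominated _ _ _ mu _ _ _ (fun t => expR (- (e * `|t|)))) => //.
  - by apply: (cmeasurable_comp (cmeasurable_poisson e s)).
  - by apply: (@integrableS _ _ _ mu setT) => //; exact: integrable_expRN_norm.
  - by move=> t _; rewrite cmod_poisson normrN.
move=> irN iiN.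
have -> : cintegral mu setT (poisson e s) = cintegral mu `]0, +oo[ (poisson e s) +
    cintegral mu `]0, +oo[ (fun t => poisson e s (- t)).
  by apply: complexP; rewrite ?cReD ?cImD/= Rintegral_opp_itv.
pose c : R[i] := (- e) +i* s; pose c' : R[i] := (- e) +i* (- s).
rewrite (@eq_cintegral _ _ _ mu _ (poisson e s) (fun t => cexp (t%:C * c))); last first.
  move=> t; rewrite /= in_itv/= andbT => t0; congr cexp; apply: complexP.
    by rewrite cReM/= (gtr0_norm t0); ring.
  by rewrite cImM/=; ring.
rewrite (@eq_cintegral _ _ _ mu _ (fun t => poisson e s (- t))
  (fun t => cexp (t%:C * c'))); last first.
  move=> t; rewrite /= in_itv/= andbT => t0; congr cexp; apply: complexP.
    by rewrite cReM/= normrN (gtr0_norm t0); ring.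
  by rewrite cImM/=; ring.
rewrite !cintegral_cexp0y /= ?oppr_lt0//.
have N0 : e ^+ 2 + s ^+ 2 != 0 by rewrite gt_eqF// ltr_pwDl ?exprn_gt0 ?sqr_ge0.
apply: complexP; rewrite /= ?sqrrN; field; exact: N0.
Qed.

Lemma poisson_denom_neq0 (e s : R) : 0 < e -> e ^+ 2 + s ^+ 2 != 0.
Proof. by move=> e0; rewrite gt_eqF// ltr_pwDl ?exprn_gt0 ?sqr_ge0. Qed.

Lemma poisson_value_bounds (e s : R) : 0 < e ->
  0 <= 2 * e / (e ^+ 2 + s ^+ 2) <= 2 / e.
Proof.
move=> e0; have d0 : 0 < e ^+ 2 + s ^+ 2 by rewrite ltr_pwDl ?exprn_gt0 ?sqr_ge0.
have en := ltW e0; have dn := ltW d0.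
rewrite divr_ge0 ?mulr_ge0//=.
rewrite ler_pdivrMr// mulrAC ler_pdivlMr// -mulrA ler_pM2l//.
by rewrite -expr2 lerDl sqr_ge0.
Qed.

(** The substitution y = x + e u yields a kernel free of e, so that the limit e -> 0 acts only on
    the function integrated against it. *)
Lemma poisson_rescale (e x u : R) : 0 < e ->
  e * (2 * e / (e ^+ 2 + (x - (x + e * u)) ^+ 2)) = 2 / (1 + u ^+ 2).
Proof.
move=> e0; have u0 : 1 + u ^+ 2 != 0 by rewrite gt_eqF// ltr_pwDl ?sqr_ge0.
rewrite (_ : e ^+ 2 + (x - (x + e * u)) ^+ 2 = e ^+ 2 * (1 + u ^+ 2)); last by ring.
by field; rewrite u0 gt_eqF.
Qed.

End PoissonKernel.

(** * Laplace inversion of y^r *)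

Section Inversion.
Context {R : realType}.
Local Notation mu := (@lebesgue_measure R).

Lemma ccvg_eq_near (u v : nat -> R[i]) l :
  (\forall n \near \oo, v n = u n) -> ccvg v l -> ccvg u l.
Proof.
move=> uv [vr vi]; split.
  by apply: cvg_trans vr; apply: near_eq_cvg; apply: filterS uv => n ->.
by apply: cvg_trans vi; apply: near_eq_cvg; apply: filterS uv => n ->.
Qed.

Lemma ccvg0P (u : nat -> R[i]) :
  (forall e, 0 < e -> \forall n \near \oo, cmod (u n) <= e) -> ccvg u 0.
Proof.
move=> h; split; apply/cvgr0Pnorm_le => e /h; apply: filterS => n; apply: le_trans.
  exact: normr_Re_le.
exact: normr_Im_le.
Qed.

Lemma cmeasurable_cauchy : cmeasurable (fun u : R => (2 / (1 + u ^+ 2))%:C).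
Proof.
apply: cmeasurable_real; apply: measurable_funM => //.
by apply: continuous_measurable_fun; exact: continuous_oneDsqrV.
Qed.

Lemma cintegrable_cauchy : cintegrable mu setT (fun u => (2 / (1 + u ^+ 2))%:C).
Proof.
apply: (@cintegrable_dominated _ _ _ mu _ _ _ (fun u => 2 * (1 + u ^+ 2)^-1)) => //.
- exact: cmeasurable_cauchy.
- by apply: integrable_realZl; [exact: measurableT|exact: integrable_oneDsqrV].
- by move=> u _; rewrite cmod_real ger0_norm// divr_ge0 ?addr_ge0 ?sqr_ge0.
Qed.

Lemma cintegral_cauchy : cintegral mu setT (fun u => (2 / (1 + u ^+ 2))%:C) = (2 * pi)%:C.
Proof.
apply: complexP => /=; last by rewrite /Rintegral integral0.
rewrite RintegralZl//; last exact: integrable_oneDsqrV.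
by rewrite /Rintegral integral_oneDsqrV.
Qed.

Variables (r : R[i]) (sigma : R).
Hypotheses (r0 : 0 < Re r) (sigma_gt0 : 0 < sigma).

(* For [0 < y], [powexp y] is y^r e^(-sigma y). *)
Definition powexp (y : R) : R[i] := cexp (r * (ln y)%:C - (sigma * y)%:C).

(** This is g, with a guard because [ln] takes a default value for y <= 0. *)
Definition powexp_pos (y : R) : R[i] := if 0 < y then powexp y else 0.

(* [vline_pow t] is w^-(r+1) at the point [w = sigma +i* t] of the line Re w = sigma. *)
Definition vline_pow (t : R) : R[i] := cexp (- ((r + 1) * clog (sigma +i* t))).

Lemma cmod_powexp y : cmod (powexp y) = expR (Re r * ln y) * expR (- (sigma * y)).
Proof. by rewrite cmod_cexp cReD cReN cReM/= mulr0 subr0 expRD. Qed.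

Lemma cmeasurable_powexp : cmeasurable powexp.
Proof.
apply: cmeasurable_cexp; apply: cmeasurableD.
  apply: cmeasurableM; first exact: cmeasurable_cst.
  by apply: cmeasurable_real; exact: measurable_ln.
by apply: cmeasurableN; apply: cmeasurable_real; exact: measurable_funM.
Qed.

Lemma cmeasurable_powexp_pos : cmeasurable powexp_pos.
Proof.
apply: cmeasurable_if; [|exact: cmeasurable_powexp|exact: cmeasurable_cst].
exact: measurable_fun_ltr.
Qed.

Lemma powexp_bound : exists2 C : R, 0 <= C & forall y, 0 < y ->
  cmod (powexp y) <= C * expR (- (sigma / 2 * `|y|)).
Proof.
have s2 : 0 < sigma / 2 by rewrite divr_gt0.
have [C C0 hC] := powR_le_expR r0 s2; exists C => // y y0.
rewrite cmod_powexp (gtr0_norm y0).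
rewrite (_ : - (sigma / 2 * y) = sigma / 2 * y - sigma * y); last by field.
by rewrite expRD mulrA ler_wpM2r ?expR_ge0 ?hC.
Qed.

Lemma powexp_pos_bound : exists2 C : R, 0 <= C & forall y,
  cmod (powexp_pos y) <= C * expR (- (sigma / 2 * `|y|)).
Proof.
have [C C0 hC] := powexp_bound; exists C => // y; rewrite /powexp_pos.
by case: ifPn => [/hC//|_]; rewrite cmod0 mulr_ge0 ?expR_ge0.
Qed.

(** Only x = 0 is delicate: to its right |g(v)| <= v^(Re r), which tends to 0 because Re r > 0. *)
Lemma powexp_pos_continuous (v : nat -> R) x :
  v n @[n --> \oo] --> x -> ccvg (fun n => powexp_pos (v n)) (powexp_pos x).
Proof.
move=> vx; have [x0|x0|x0] := ltgtP x 0.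
- rewrite {2}/powexp_pos ltNge (ltW x0)/=; apply: ccvg_near.
  have : \forall n \near \oo, v n < 0 by move/cvgr_lt : vx; apply.
  by apply: filterS => n vn; rewrite /powexp_pos ltNge (ltW vn).
- rewrite {2}/powexp_pos x0.
  apply: (@ccvg_eq_near _ (fun n => powexp (v n))).
    have : \forall n \near \oo, 0 < v n by move/cvgr_gt : vx; apply.
    by apply: filterS => n vn; rewrite /powexp_pos vn.
  apply: ccvg_cexp; apply: ccvgB.
    apply: ccvgM; [exact: ccvg_cst|apply: ccvg_real].
    by apply: continuous_cvg vx; exact: continuous_ln.
  by apply: ccvg_real; apply: cvgM => //; exact: cvg_cst.
- rewrite {2}/powexp_pos x0 ltxx; apply: ccvg0P => e e0.
  (* The radius solves v^(Re r) = e. *)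
  have : \forall n \near \oo, `|v n| < expR (ln e / Re r).
    by move: vx; rewrite x0 => /cvgr0_norm_lt; apply; exact: expR_gt0.
  apply: filterS => n vn; rewrite /powexp_pos.
  case: ifPn => [v0|_]; last by rewrite cmod0 ltW.
  rewrite (gtr0_norm v0) in vn; rewrite cmod_powexp.
  have eE : expR (Re r * ln (v n)) <= e.
    rewrite -[leRHS](@lnK _ e) ?posrE// ler_expR mulrC -ler_pdivlMr//.
    by rewrite -[leRHS]expRK ler_ln ?posrE ?expR_gt0// ltW.
  rewrite -[leRHS]mulr1; apply: ler_pM => //; rewrite ?expR_ge0//.
  by rewrite -expR0 ler_expR oppr_le0 mulr_ge0// ltW.
Qed.

(** The modulus of w^-(r+1) is |w|^-(Re r + 1) e^(Im r arg w). The constant comes from sigma + |t|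
    <= 2 |w| and |arg w| < pi/2. *)
Lemma vline_pow_bound : exists2 M : R, 0 <= M & forall t,
  cmod (vline_pow t) <= M * expR (- ((Re r + 1) * ln (sigma + `|t|))).
Proof.
exists (expR ((Re r + 1) * ln 2 + `|Im r| * (pi / 2))); first exact: expR_ge0.
move=> t; rewrite cmod_cexp -expRD ler_expR.
have w0 : 0 < Re (sigma +i* t) by [].
have st : 0 < sigma + `|t| by rewrite ltr_pwDl.
have m0 : 0 < cmod (sigma +i* t).
  by rewrite (lt_le_trans w0)// (le_trans _ (normr_Re_le _))// ler_norm.
have hm : ln (sigma + `|t|) <= ln 2 + ln (cmod (sigma +i* t)).
  rewrite -lnM ?posrE// ler_ln ?posrE ?mulr_gt0// mulrDl !mul1r lerD//.
    by rewrite (le_trans _ (normr_Re_le _))//= ler_norm.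
  by rewrite (le_trans _ (normr_Im_le _)).
rewrite cReN cReM /clog/= cReD cImD/= addr0 opprB.
have ha : Im r * carg (sigma +i* t) <= `|Im r| * (pi / 2).
  by rewrite (le_trans (ler_norm _))// normrM ler_wpM2l// ltW// normr_carg_lt.
rewrite addrC [leRHS]addrAC; apply: lerD => //.
by rewrite -mulrBr -mulrN ler_pM2l ?addr_gt0// lerNl opprB lerBlDl.
Qed.

Lemma cmeasurable_vline_pow : cmeasurable vline_pow.
Proof.
apply: cmeasurable_cexp; apply: cmeasurableN; apply: cmeasurableM.
  exact: cmeasurable_cst.
apply: cmeasurable_pair.
  apply: measurableT_comp; first exact: measurable_ln.
  apply: measurableT_comp.
    by apply: continuous_measurable_fun; exact: sqrt_continuous.
  by apply: measurable_funD => //=; apply: measurable_funX.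
under eq_fun do rewrite carg_Re_gt0//=.
apply: measurableT_comp.
  by apply: continuous_measurable_fun; exact: continuous_atan.
exact: measurable_funM.
Qed.

(** This is the Fourier transform of g, obtained from [cintegral_Gamma_cexp] at zeta = log w; Re w =
    sigma > 0 keeps |Im zeta| below pi/2. *)
Lemma cintegral_powexp_cexp t :
  cintegral mu `]0, +oo[ (fun y => powexp y * cexp (0 +i* (- (t * y)))) =
  cGamma (r + 1) * vline_pow t.
Proof.
rewrite /vline_pow -cintegral_Gamma_cexp//; last exact: normr_carg_lt.
apply: eq_cintegral => y _; rewrite -cexpD clogK//; congr cexp.
rewrite -addrA; congr (_ + _).
by apply: complexP; rewrite ?cReD ?cImD ?cReN ?cImN ?cReM ?cImM/=; ring.
Qed.

(** The damping makes the double integral in (t, y) absolutely convergent. After the exchange the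
    t-integral is the Poisson kernel at x - y, which y = x + e u rescales. *)
Let damped_integral (e x : R) (e0 : 0 < e) :
  cintegral mu setT (fun t => cGamma (r + 1) * vline_pow t * poisson e x t) =
  cintegral mu setT (fun u => powexp_pos (x + e * u) * (2 / (1 + u ^+ 2))%:C).
Proof.
have [C C0 hC] := powexp_bound.
have s2 : 0 < sigma / 2 by rewrite divr_gt0.
have iC : mu.-integrable setT (fun y => (C * expR (- (sigma / 2 * `|y|)))%:E).
  apply: integrable_realZl; first exact: measurableT.
  exact: integrable_expRN_norm.
pose f (z : R * R) := poisson e (x - z.2) z.1 * powexp z.2.
have mf : cmeasurable f.
  apply: cmeasurableM.
    apply: cmeasurable_cexp; apply: cmeasurable_pair.
      apply: measurableT_comp => //; apply: measurable_funM => //.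
      by apply: measurableT_comp => //; exact: measurable_fst.
    apply: measurable_funM; first exact: measurable_fst.
    by apply: measurable_funB => //; exact: measurable_snd.
  by apply: (cmeasurable_comp cmeasurable_powexp); exact: measurable_snd.
have iC0 : mu.-integrable `]0, +oo[ (fun y => (C * expR (- (sigma / 2 * `|y|)))%:E).
  by apply: (@integrableS _ _ _ mu setT).
have [//|//||_ fub] := @cintegral_Fubini _ _ _ _ R mu mu setT `]0, +oo[
  (fun t => expR (- (e * `|t|))) (fun y => C * expR (- (sigma / 2 * `|y|))) _ _
  (integrable_expRN_norm e0) iC0 f mf _.
  move=> t y _; rewrite /= in_itv/= andbT => y0.
  by rewrite /f (cmodM (poisson _ _ _)) cmod_poisson ler_wpM2l ?expR_ge0// hC.
transitivity (cintegral mu setT (fun t => cintegral mu `]0, +oo[ (fun y => f (t, y)))).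
  apply: eq_cintegral => t _; rewrite -cintegral_powexp_cexp mulrC -cintegralZ; last 2 first.
  - exact: measurable_itv.
  - apply: (@cintegrable_dominated _ _ _ mu _ _ _ (fun y => C * expR (- (sigma / 2 * `|y|)))).
    + exact: measurable_itv.
    + apply: cmeasurableM; first exact: cmeasurable_powexp.
      apply: cmeasurable_cexp; apply: cmeasurable_pair; first exact: measurable_cst.
      by apply: measurableT_comp => //; exact: measurable_funM.
    + exact: iC0.
    + move=> y; rewrite /= in_itv/= andbT => y0.
      by rewrite (cmodM (powexp y)) cmod_cexp expR0 mulr1 hC.
  apply: eq_cintegral => y _; rewrite /f/= /poisson /powexp -!cexpD; congr cexp.
  by apply: complexP; rewrite ?cReD ?cImD ?cReN ?cImN ?cReM ?cImM/=; ring.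
rewrite fub.
transitivity (cintegral mu `]0, +oo[ (fun y => powexp_pos y *
    (2 * e / (e ^+ 2 + (x - y) ^+ 2))%:C)).
  apply: eq_cintegral => y; rewrite /= in_itv/= andbT => y0.
  rewrite /powexp_pos y0 -(cintegral_poisson _ e0) -cintegralZ; last 2 first.
  - exact: measurableT.
  - exact: cintegrable_poisson.
  by apply: eq_cintegral => t _; rewrite mulrC.
(* On the whole line, where the integrand vanishes for y <= 0, the affine substitution maps the
   domain onto itself. *)
rewrite -cintegral_restrict.
set G := (fun y : R => powexp_pos y * (2 * e / (e ^+ 2 + (x - y) ^+ 2))%:C).
have GE y : (\1_`]0, +oo[ y)%:C * G y = G y.
  rewrite indicE /G /powexp_pos; case: ifPn => y0; last by rewrite mul0r mulr0.
  have yE : y \in (`]0, +oo[%classic : set R) by rewrite inE/= in_itv/= andbT.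
  by rewrite yE mul1r.
rewrite (@eq_cintegral _ _ _ mu setT _ G) => [|y _]; last exact: GE.
(* For fixed e the kernel is at most 2 / e, so the exponential bound on g suffices. *)
have [iGr iGi] : cintegrable mu setT G.
  have [B B0 hB] := powexp_pos_bound.
  apply: (@cintegrable_dominated _ _ _ mu _ _ _
    (fun y => 2 / e * B * expR (- (sigma / 2 * `|y|)))).
  - exact: measurableT.
  - apply: cmeasurableM; first exact: cmeasurable_powexp_pos.
    apply: cmeasurable_real; apply: continuous_measurable_fun => y.
    apply: cvgM; first exact: cvg_cst.
    apply: cvgV; first exact: poisson_denom_neq0.
    apply: cvgD; first exact: cvg_cst.
    by apply: cvgM; apply: cvgB; [exact: cvg_cst|exact: cvg_id|exact: cvg_cst|exact: cvg_id].
  - apply: integrable_realZl; first exact: measurableT.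
    exact: integrable_expRN_norm.
  - move=> y _; have /andP[k0 k1] := poisson_value_bounds (x - y) e0.
    rewrite (cmodM (powexp_pos y)) cmod_real (ger0_norm k0) mulrC -[leRHS]mulrA.
    exact: (ler_pM k0 (cmod_ge0 _) k1 (hB y)).
have GcE u : (e%:C) * G (x + e * u) = powexp_pos (x + e * u) * (2 / (1 + u ^+ 2))%:C.
  rewrite /G mulrCA -rmorphM/=; congr (_ * _%:C).
  exact: poisson_rescale.
transitivity (e%:C * cintegral mu setT (fun u => G (x + e * u))).
  apply: complexP.
    by rewrite [RHS]cReM mul0r subr0; exact: (Rintegral_affine x e0 iGr).
  by rewrite [RHS]cImM mul0r addr0; exact: (Rintegral_affine x e0 iGi).
rewrite -cintegralZ; first by apply: eq_cintegral => u _; exact: GcE.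
  exact: measurableT.
by split; [exact: (integrable_affine _ e0 iGr)|exact: (integrable_affine _ e0 iGi)].
Qed.

Lemma cintegral_vline_pow x :
  cGamma (r + 1) * cintegral mu setT (fun t => vline_pow t * cexp (0 +i* (t * x))) =
  (2 * pi)%:C * powexp_pos x.
Proof.
have [M M0 hM] := vline_pow_bound; have [C C0 hC] := powexp_pos_bound.
have iM (c : R) : mu.-integrable setT
    (fun t => (c * (M * expR (- ((Re r + 1) * ln (sigma + `|t|)))))%:E).
  apply: integrable_realZl; first exact: measurableT.
  apply: integrable_realZl; first exact: measurableT.
  exact: integrable_powRN_norm.
have mv : cmeasurable (fun t => vline_pow t * cexp (0 +i* (t * x))).
  apply: cmeasurableM; first exact: cmeasurable_vline_pow.
  by apply: cmeasurable_cexp; apply: cmeasurable_pair => //; exact: measurable_funM.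
rewrite -cintegralZ//; last first.
  apply: (@cintegrable_dominated _ _ _ mu _ _ _
    (fun t => 1 * (M * expR (- ((Re r + 1) * ln (sigma + `|t|)))))) => //.
  by move=> t _; rewrite (cmodM (vline_pow t)) cmod_cexp expR0 mulr1 mul1r.
have e0 n : 0 < n.+2%:R^-1 :> R by [].
(* The damped integrals with e = 1 / (n + 2) are shown to converge to both sides. *)
apply: (@ccvg_unique _ (fun n => cintegral mu setT
    (fun t => cGamma (r + 1) * vline_pow t * poisson n.+2%:R^-1 x t))).
  apply: (@cintegral_dominated_cvg _ _ _ mu setT measurableT
    (fun n t => cGamma (r + 1) * vline_pow t * poisson n.+2%:R^-1 x t)
    (fun t => cGamma (r + 1) * (vline_pow t * cexp (0 +i* (t * x))))
    (fun t => cmod (cGamma (r + 1)) * (M * expR (- ((Re r + 1) * ln (sigma + `|t|)))))) => //.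
  - move=> n; apply: cmeasurableM; last exact: cmeasurable_poisson.
    by apply: cmeasurableM; [exact: cmeasurable_cst|exact: cmeasurable_vline_pow].
  - by apply: cmeasurableM => //; exact: cmeasurable_cst.
  - move=> n t _; rewrite (cmodM (_ * _)) (cmodM (cGamma _)) cmod_poisson -mulrA.
    rewrite ler_wpM2l ?cmod_ge0// -[leRHS]mulr1; apply: ler_pM; rewrite ?cmod_ge0 ?expR_ge0//.
  - move=> t _; under eq_fun do rewrite -mulrA.
    apply: ccvgM; first exact: ccvg_cst.
    apply: ccvgM; first exact: ccvg_cst.
    apply: ccvg_cexp; split => /=; last exact: cvg_cst.
    rewrite -[X in _ --> X]oppr0 -[X in _ --> - X](mul0r `|t|); apply: cvgN.
    by apply: cvgM; [exact: cvg_invSS|exact: cvg_cst].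
(* On the Poisson side n enters only through the argument of [powexp_pos], against the fixed kernel
   2 / (1 + u^2) of mass 2 pi. *)
under eq_fun do rewrite damped_integral//.
have -> : (2 * pi)%:C * powexp_pos x =
    cintegral mu setT (fun u => powexp_pos x * (2 / (1 + u ^+ 2))%:C).
  rewrite cintegralZ; last 2 first.
  - exact: measurableT.
  - exact: cintegrable_cauchy.
  by rewrite cintegral_cauchy mulrC.
apply: (@cintegral_dominated_cvg _ _ _ mu setT measurableT
    (fun n u => powexp_pos (x + n.+2%:R^-1 * u) * (2 / (1 + u ^+ 2))%:C)
    (fun u => powexp_pos x * (2 / (1 + u ^+ 2))%:C)
    (fun u => C * 2 * (1 + u ^+ 2)^-1)).
- move=> n; apply: cmeasurableM; last exact: cmeasurable_cauchy.
  apply: (cmeasurable_comp cmeasurable_powexp_pos).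
  by apply: measurable_funD => //; exact: measurable_funM.
- by apply: cmeasurableM; [exact: cmeasurable_cst|exact: cmeasurable_cauchy].
- by apply: integrable_realZl; [exact: measurableT|exact: integrable_oneDsqrV].
- move=> n u _; rewrite (cmodM (powexp_pos _)) cmod_real -mulrA.
  rewrite ger0_norm ?divr_ge0 ?addr_ge0 ?sqr_ge0//.
  rewrite ler_wpM2r ?divr_ge0 ?addr_ge0 ?sqr_ge0// (le_trans (hC _))// ler_piMr//.
  by rewrite -expR0 ler_expR oppr_le0 mulr_ge0// divr_ge0// ltW.
- move=> u _; apply: ccvgM; last exact: ccvg_cst.
  apply: powexp_pos_continuous; rewrite -[X in _ --> X]addr0 -[X in _ + X](mul0r u).
  apply: cvgD; first exact: cvg_cst.
  by apply: cvgM; [exact: cvg_invSS|exact: cvg_cst].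
Qed.

End Inversion.

(** * The moment formula *)

Section MomentFormula.
Context {R : realType}.
Local Notation mu := (@lebesgue_measure R).
Variables (r : R[i]) (sigma : R).
Hypotheses (r0 : 0 < Re r) (sigma_gt0 : 0 < sigma).

Definition cpow_pos (x : R) : R[i] := if 0 < x then cexp (r * (ln x)%:C) else 0.

Lemma cpow_norm x : cpow `|x|%:C r = cpow_pos x + cpow_pos (- x).
Proof.
rewrite /cpow_pos; have [x0|x0|->] := ltgtP x 0.
- by rewrite oppr_gt0 x0 add0r ltr0_norm// cpow_real// oppr_gt0.
- by rewrite oppr_gt0 ltNge (ltW x0) addr0 gtr0_norm// cpow_real.
(* At 0 both sides vanish: [cpow] is 1 at base 0 only for exponent 0, which Re r > 0 excludes. *)
- rewrite normr0 oppr0 ltxx addr0 /cpow eqxx.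
  by have [rE|//] := eqVneq r 0; move: r0; rewrite rE ltxx.
Qed.

Lemma cmeasurable_cpow_pos : cmeasurable cpow_pos.
Proof.
apply: cmeasurable_if; [exact: measurable_fun_ltr| |exact: cmeasurable_cst].
apply: cmeasurable_cexp; apply: cmeasurableM; first exact: cmeasurable_cst.
by apply: cmeasurable_real; exact: measurable_ln.
Qed.

(** The integrability of |X|^r rests on this comparison with the exponentials assumed integrable. *)
Lemma cpow_pos_bound : exists2 C : R, 0 <= C & forall x,
  cmod (cpow_pos x) <= C * expR (sigma * x).
Proof.
have [C C0 hC] := powR_le_expR r0 sigma_gt0; exists C => // x.
rewrite /cpow_pos; case: ifPn => [x0|_]; last by rewrite cmod0 mulr_ge0 ?expR_ge0.
by rewrite cmod_cexp cReM/= mulr0 subr0 hC.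
Qed.

Lemma cmod_cexp_vline (t x : R) : cmod (cexp ((sigma +i* t) * x%:C)) = expR (sigma * x).
Proof. by rewrite cmod_cexp cReM/= mulr0 subr0. Qed.

Lemma cintegrable_cexp_vline x :
  cintegrable mu setT (fun t => cexp ((sigma +i* t) * x%:C) * vline_pow r sigma t).
Proof.
have [M M0 hM] := vline_pow_bound r0 sigma_gt0.
apply: (@cintegrable_dominated _ _ _ mu _ _ _
  (fun t => expR (sigma * x) * (M * expR (- ((Re r + 1) * ln (sigma + `|t|)))))).
- exact: measurableT.
- apply: cmeasurableM; last exact: cmeasurable_vline_pow.
  apply: cmeasurable_cexp; apply: cmeasurableM; last exact: cmeasurable_cst.
  by apply: cmeasurable_pair; [exact: measurable_cst|exact: measurable_id].
- apply: integrable_realZl; first exact: measurableT.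
  apply: integrable_realZl; first exact: measurableT.
  exact: integrable_powRN_norm.
- by move=> t _; rewrite (cmodM (cexp _)) cmod_cexp_vline ler_wpM2l ?expR_ge0.
Qed.

(** The factor e^(sigma x) of e^(w x) leaves the t-integral and cancels the e^(-sigma x) of
    [powexp], which turns the inversion of g into that of (x_+)^r. *)
Lemma cintegral_cexp_vline x :
  cGamma (r + 1) *
    cintegral mu setT (fun t => cexp ((sigma +i* t) * x%:C) * vline_pow r sigma t) =
  (2 * pi)%:C * cpow_pos x.
Proof.
have -> : (2 * pi)%:C * cpow_pos x =
    cexp (sigma * x)%:C * ((2 * pi)%:C * powexp_pos r sigma x).
  rewrite mulrCA; congr (_ * _); rewrite /cpow_pos /powexp_pos.
  by case: ifPn => _; [rewrite /powexp -cexpD addrC subrK|rewrite mulr0].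
rewrite -(cintegral_vline_pow r0 sigma_gt0) mulrCA; congr (_ * _).
rewrite -cintegralZ; last 2 first.
- exact: measurableT.
- have := @cintegrableZ _ _ _ mu _ measurableT (cexp (- (sigma * x)%:C)) _
    (cintegrable_cexp_vline x).
  apply: eq_cintegrable; first exact: measurableT.
  move=> t _; rewrite mulrA -cexpD mulrC; congr (_ * cexp _).
  by apply: complexP; rewrite ?cReD ?cImD ?cReN ?cImN ?cReM ?cImM/=; ring.
apply: eq_cintegral => t _; rewrite [RHS]mulrCA [RHS]mulrC; congr (_ * _).
rewrite -cexpD; congr cexp.
by apply: complexP; rewrite ?cReD ?cImD ?cReM ?cImM/=; ring.
Qed.

Lemma cpow_vlineV (t : R) : (cpow (sigma +i* t) (r + 1))^-1 = vline_pow r sigma t.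
Proof.
rewrite /cpow /vline_pow cexpN ifF//; apply/negbTE.
by rewrite eq_complex/= gt_eqF.
Qed.

End MomentFormula.

Lemma integrable_expR_mgf {R : realType} {d : measure_display} {T : measurableType d}
    (P : probability T R) (X : {RV P >-> R}) (s : R) :
  ('M_P X s < +oo)%E -> P.-integrable setT (fun x => (expR (s * X x))%:E).
Proof.
rewrite /mmt_gen_fun unlock => iX; apply/integrableP; split.
  apply/measurable_EFinP; apply: measurableT_comp => //.
  by apply: measurable_funM => //; exact: measurable_funPT.
under eq_integral do rewrite gee0_abs ?lee_fin ?expR_ge0//.
by apply: le_lt_trans iX; under eq_integral do rewrite mulrC.
Qed.

Theorem theorem1 (R : realType) (d : measure_display) (T : measurableType d)
  (P : probability T R) (X : {RV P >-> R})
  (sigma : R) (sigma_gt0 : 0 < sigma)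
  (mgf_pos : ('M_P X sigma < +oo)%E) (mgf_neg : ('M_P X (- sigma) < +oo)%E)
  (r : R[i]) (Re_r_gt0 : 0 < complex.Re r) :
  let w (t : R) : R[i] := sigma +i* t in
  let integrand (t : R) : R[i] :=
    (cmgf P X (w t) + cmgf P X (- w t)) / cpow (w t) (r + 1) in
  (* the expectations and the integral in the formula converge absolutely *)
  [/\ forall t : R, cintegrable P setT (fun x => cexp (w t * (X x)%:C)) /\
                    cintegrable P setT (fun x => cexp (- w t * (X x)%:C)),
      cintegrable P setT (fun x => cpow `|X x|%:C r),
      cintegrable lebesgue_measure setT integrand &
      cexpectation P (fun x => cpow `|X x|%:C r) =
        cGamma (r + 1) / (2 * pi)%:C * cintegral lebesgue_measure setT integrand].
Proof.
move=> w integrand.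
have ip := integrable_expR_mgf mgf_pos.
have im := integrable_expR_mgf mgf_neg.
have mX : measurable_fun setT (X : T -> R) by exact: measurable_funPT.
(* M_X(-w) is the transform of -X at w, so one inversion formula serves both terms. *)
have wN t x : - w t * x%:C = w t * (- x)%:C by rewrite rmorphN/= mulNr mulrN.
(* [h] is the sum of the moduli of e^(w X) and e^(-w X), and is independent of t. *)
pose h x : R := expR (sigma * X x) + expR (- sigma * X x).
have ih : P.-integrable setT (fun x => (h x)%:E).
  by rewrite /h; under eq_fun do rewrite EFinD; exact: integrableD.
have mC : cmeasurable (fun x => (X x)%:C) by exact: cmeasurable_real.
have iE t : cintegrable P setT (fun x => cexp (w t * (X x)%:C)).
  apply: (@cintegrable_dominated _ _ _ P _ _ _ (fun x => expR (sigma * X x))) => //.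
    by apply: cmeasurable_cexp; apply: cmeasurableM => //; exact: cmeasurable_cst.
  by move=> x _; rewrite cmod_cexp_vline.
have iEN t : cintegrable P setT (fun x => cexp (- w t * (X x)%:C)).
  apply: (@cintegrable_dominated _ _ _ P _ _ _ (fun x => expR (- sigma * X x))) => //.
    by apply: cmeasurable_cexp; apply: cmeasurableM => //; exact: cmeasurable_cst.
  by move=> x _; rewrite wN cmod_cexp_vline mulrN mulNr.
have iX : cintegrable P setT (fun x => cpow `|X x|%:C r).
  have [C C0 hC] := cpow_pos_bound Re_r_gt0 sigma_gt0.
  apply: (@cintegrable_dominated _ _ _ P _ _ _ (fun x => C * h x)).
  - exact: measurableT.
  - under eq_fun do rewrite cpow_norm//.
    apply: cmeasurableD; first exact: (cmeasurable_comp (cmeasurable_cpow_pos r)).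
    apply: (cmeasurable_comp (cmeasurable_cpow_pos r)).
    exact: measurableT_comp.
  - by apply: integrable_realZl; first exact: measurableT.
  - move=> x _; rewrite cpow_norm// (le_trans (le_cmodD _ _))// /h mulrDr lerD ?hC//.
    by rewrite mulNr -mulrN hC.
have [M M0 hM] := vline_pow_bound Re_r_gt0 sigma_gt0.
pose Q := vline_pow r sigma.
have iM : lebesgue_measure.-integrable setT
    (fun t => (M * expR (- ((Re r + 1) * ln (sigma + `|t|))))%:E).
  apply: integrable_realZl; first exact: measurableT.
  exact: integrable_powRN_norm.
pose F t x : R[i] := (cexp (w t * (X x)%:C) + cexp (- w t * (X x)%:C)) * Q t.
have Fh t x : cmod (F t x) <= M * expR (- ((Re r + 1) * ln (sigma + `|t|))) * h x.
  rewrite /F (cmodM (_ + _)) mulrC.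
  apply: ler_pM; [exact: cmod_ge0|exact: cmod_ge0|exact: hM|].
  rewrite (le_trans (le_cmodD _ _))// wN !cmod_cexp_vline /h lerD//.
  by rewrite mulrN mulNr.
(* Arbitrary coordinate maps are allowed because both orders of the product space occur below. *)
have mF d1 (S : measurableType d1) (ft : S -> R) (fx : S -> T) :
    measurable_fun setT ft -> measurable_fun setT fx ->
    cmeasurable (fun z => F (ft z) (fx z)).
  move=> mt mx.
  have mw : cmeasurable (fun z => w (ft z)).
    by apply: cmeasurable_pair; [exact: measurable_cst|exact: mt].
  have mXx : cmeasurable (fun z => (X (fx z))%:C) by exact: (cmeasurable_comp mC mx).
  apply: cmeasurableM; last exact: (cmeasurable_comp (cmeasurable_vline_pow r sigma_gt0)).
  apply: cmeasurableD; apply: cmeasurable_cexp; apply: cmeasurableM => //.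
  exact: cmeasurableN.
(* This order gives the integrability of [integrand] in t; the opposite order gives the exchange and
   the integrability over the probability space. *)
have [//|//||| iI _] := @cintegral_Fubini _ _ _ _ R lebesgue_measure P setT setT _ _ _ _
  iM ih (fun z => F z.1 z.2) _ _.
- by apply: mF; [exact: measurable_fst|exact: measurable_snd].
- by move=> t x _ _; exact: Fh.
have [//|//||| iJ JE] := @cintegral_Fubini _ _ _ _ R P lebesgue_measure setT setT _ _ _ _
  ih iM (fun z => F z.2 z.1) _ _.
- by apply: mF; [exact: measurable_snd|exact: measurable_fst].
- by move=> x t _ _; rewrite mulrC; exact: Fh.
(* Dividing by w^(r+1) is multiplying by [Q t], which is constant in x and leaves the
   expectation. *)
have integrandE t : cintegral P setT (fun x => F t x) = integrand t.
  rewrite /integrand cpow_vlineV// mulrC -/(Q t) -[cmgf P X _ + _]cintegralD //.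
  rewrite -cintegralZ; last 2 first.
  - exact: measurableT.
  - exact: cintegrableD.
  by apply: eq_cintegral => x _; rewrite mulrC.
split.
- by move=> t; split; [exact: iE|exact: iEN].
- exact: iX.
- by apply: eq_cintegrable iI; [exact: measurableT|move=> t _; exact: integrandE].
- rewrite -(@eq_cintegral _ _ _ lebesgue_measure setT _ integrand (fun t _ => integrandE t)).
  rewrite -JE -cintegralZ; last 2 first.
  - exact: measurableT.
  - exact: iJ.
  apply: eq_cintegral => x _.
  rewrite cpow_norm//.
  (* For each x the t-integral splits into the inversion formulas at X x and at - X x, whose values
     add up to a multiple of |X x|^r. *)
  have -> : cintegral lebesgue_measure setT (fun t => F t x) =
      cintegral lebesgue_measure setT (fun t => cexp (w t * (X x)%:C) * Q t) +
      cintegral lebesgue_measure setT (fun t => cexp (w t * (- X x)%:C) * Q t).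
    rewrite -cintegralD.
    - by apply: eq_cintegral => t _; rewrite /F mulrDl wN.
    - exact: measurableT.
    - exact: cintegrable_cexp_vline.
    - exact: cintegrable_cexp_vline.
  have pi0 : (2 * pi)%:C != 0 :> R[i].
    by rewrite eq_complex/= eqxx andbT mulf_neq0 ?gt_eqF ?pi_gt0.
  by rewrite mulrAC mulrDr !cintegral_cexp_vline// -mulrDr mulrAC mulfV// mul1r.
Qed.
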